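(* Let $A$ be a quantum system of finite dimension $d_A\ge 2$, let $B=B_1\ldots B_n$ be a composite of $n\geq 1$ finite-dimensional quantum systems, and let $\Lambda_{A\to B}$ be a quantum channel from $A$ to $B$. For a subset $R\subset\{B_1,\ldots,B_n\}$ let $\Lambda_{A\to R}=\operatorname{tr}_{\bar R}\circ\Lambda_{A\to B}$ be the reduced channel onto $R$, obtained by tracing out the complement $\bar R=\{B_1,\ldots,B_n\}\setminus R$. Then for any $q,r\in\{1,\ldots,n\}$ there exist a POVM $(M_\alpha^A)_\alpha$ on $A$ and a subset $Q\subset\{B_1,\ldots,B_n\}$ of size $|Q|=q$ with the following property: for all subsets $R\subset\{B_1,\ldots,B_n\}$ of size $|R|=r$ disjoint from $Q$ there exist states $(\sigma_\alpha^R)_\alpha$ on $R$ such that the measure-and-broadcast channel $\mathcal{E}_{A\to R}(x)=\sum_\alpha\operatorname{tr}(M_\alpha^A x)\,\sigma_\alpha^R$ satisfies $$\|\Lambda_{A\to R}-\mathcal{E}_{A\to R}\|_\diamond\le d_A\,\Omega_{d_A,d_R}\sqrt{2\ln(d_A)\,\frac{|R|}{|Q|}},$$ where $d_R$ is the Hilbert space dimension of $R$ and $$\Omega_{d_A,d_R}=\begin{cases}\min\{4,\,2d_R-1\} & \text{if } d_A=2,\\ \min\{2\sqrt2\,d_A,\,2d_R-1\} & \text{if } d_A\ge3.\end{cases}$$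
   Context: A quantum channel is a completely positive trace-preserving linear map between spaces of matrices (operators on the respective Hilbert spaces). The Hilbert space of $B=B_1\ldots B_n$ is the tensor product of those of the $B_i$, and the Hilbert space of a subset $R$ is the tensor product of the Hilbert spaces of the $B_i\in R$ ($|R|$ counts the number of subsystems, $d_R$ is the dimension). A POVM (measurement) on $A$ is a finite family of positive semidefinite operators on the Hilbert space of $A$ summing to the identity; a state is a positive semidefinite operator of trace one. For a Hermiticity-preserving linear map $\Gamma$ from $k\times k$ to $l\times l$ selfadjoint matrices, $\|\Gamma\|_{1\to1}=\sup_{x\ne0}\|\Gamma(x)\|_1/\|x\|_1$, with the supremum over selfadjoint $k\times k$ matrices $x$ and $\|\cdot\|_1$ the trace norm, and the diamond norm is $\|\Gamma\|_\diamond=\sup_{m\in\mathbb{N}}\|\Gamma\otimes\mathrm{id}_m\|_{1\to1}$, where $\mathrm{id}_m$ is the identity on the space of $m\times m$ selfadjoint matrices. *)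

(* Defs.v *)
From HB Require Import structures.
From mathcomp Require Import all_boot all_order all_algebra.
From mathcomp Require Import complex mxtens.
From mathcomp Require Import all_classical all_reals all_analysis.

Set Implicit Arguments.
Unset Strict Implicit.
Unset Printing Implicit Defensive.

Import Order.TTheory GRing.Theory Num.Theory.

Local Open Scope classical_set_scope.
Local Open Scope ring_scope.
Local Open Scope sesquilinear_scope.
Local Open Scope complex_scope.

Section Operators.
Variable K : realType.

Definition psdmx (k : nat) (x : 'M[K[i]]_k) : Prop :=
  x \is hermsymmx /\ forall v : 'cV[K[i]]_k, 0 <= (v^t* *m x *m v) 0 0.

Definition is_state (k : nat) (x : 'M[K[i]]_k) : Prop :=
  psdmx x /\ \tr x = 1.

Definition is_povm (k : nat) (I : finType) (M : I -> 'M[K[i]]_k) : Prop :=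
  (forall a, psdmx (M a)) /\ \sum_a M a = 1%:M.

(* [@tens_id k l p G] is the map G (x) id_p on operators on C^k (x) C^p: G is
   applied to each of the k x k blocks of x indexed by a pair of basis vectors
   of C^p.  It is determined by its values on tensors, see [tens_id_tens]. *)
Definition tens_id (k l p : nat) (G : 'M[K[i]]_k -> 'M[K[i]]_l)
    (x : 'M[K[i]]_(k * p)) : 'M[K[i]]_(l * p) :=
  \matrix_(u, v)
    let: (i, a) := mxtens_unindex u in
    let: (j, b) := mxtens_unindex v in
    G (\matrix_(s, t) x (mxtens_index (s, a)) (mxtens_index (t, b))) i j.

Lemma tens_id_tens (k l p : nat) (G : {linear 'M[K[i]]_k -> 'M[K[i]]_l})
    (x : 'M[K[i]]_k) (y : 'M[K[i]]_p) :
  tens_id G (x *t y) = G x *t y.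
Proof.
apply/matrixP => u v; case: (mxtens_indexP u) => i a.
case: (mxtens_indexP v) => j b; rewrite mxE !mxtens_indexK tensmxE.
rewrite (_ : \matrix_(s, t) _ = y a b *: x); last first.
  by apply/matrixP => s t; rewrite !mxE !mxtens_indexK /= mulrC.
by rewrite linearZ mxE mulrC.
Qed.

Definition completely_positive (k l : nat) (G : 'M[K[i]]_k -> 'M[K[i]]_l) :
    Prop :=
  forall (p : nat) (x : 'M[K[i]]_(k * p)), psdmx x -> psdmx (tens_id G x).

Definition trace_preserving (k l : nat) (G : 'M[K[i]]_k -> 'M[K[i]]_l) : Prop :=
  forall x, \tr (G x) = \tr x.

Definition quantum_channel (k l : nat) (G : {linear 'M[K[i]]_k -> 'M[K[i]]_l}) :
    Prop :=
  completely_positive G /\ trace_preserving G.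

(* tr |x| with |x| = sqrt (x^* x), that is, the sum of the singular values *)
Definition trace_norm (k : nat) (x : 'M[K[i]]_k) : K :=
  complex.Re (\sum_(i < k) sqrtC (spectral_diag (x^t* *m x) 0 i)).

(* Suprema are taken in the extended reals, so that no junk value can arise
   from an unbounded set. *)
Definition norm1to1 (k l : nat) (G : 'M[K[i]]_k -> 'M[K[i]]_l) : \bar K :=
  ereal_sup [set (trace_norm (G x) / trace_norm x)%:E
            | x in [set x : 'M[K[i]]_k | x \is hermsymmx /\ x != 0]].

Definition diamond_norm (k l : nat) (G : 'M[K[i]]_k -> 'M[K[i]]_l) : \bar K :=
  ereal_sup [set norm1to1 (@tens_id k l m G) | m in [set m | (0 < m)%N]].

Definition measure_prepare (k l : nat) (I : finType) (M : I -> 'M[K[i]]_k)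
    (sigma : I -> 'M[K[i]]_l) (x : 'M[K[i]]_k) : 'M[K[i]]_l :=
  \sum_a \tr (M a *m x) *: sigma a.

End Operators.

(* The system B_i (i : 'I_n) has Hilbert space C^(d i), with basis 'I_(d i).
   The tensor product of the B_i with i in R has as a basis the families of
   basis vectors of its factors; matrices are indexed by the rank of a family
   in the enumeration of its type. *)
Section Composite.
Variables (n : nat) (d : 'I_n -> nat).

Definition full_basis : finType := {dffun forall i : 'I_n, 'I_(d i)}.

Definition sub_basis (R : {set 'I_n}) : finType :=
  {dffun forall i : {i : 'I_n | i \in R}, 'I_(d (val i))}.

Definition dim_full : nat := #|full_basis|.

Definition dim_sub (R : {set 'I_n}) : nat := #|sub_basis R|.

Lemma dim_fullE : dim_full = (\prod_i d i)%N.
Proof.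
rewrite /dim_full card_dep_ffun foldrE big_map big_enum.
by apply: eq_bigr => i _; rewrite card_ord.
Qed.

Lemma dim_subE (R : {set 'I_n}) : dim_sub R = (\prod_(i in R) d i)%N.
Proof.
rewrite /dim_sub card_dep_ffun foldrE big_map big_enum /=.
rewrite (eq_bigr (fun i => d (val i))) => [|i _]; last by rewrite card_ord.
by rewrite [RHS]big_sub; apply: eq_bigl => i.
Qed.

Definition restr (R : {set 'I_n}) (u : full_basis) : sub_basis R :=
  [ffun i : {i : 'I_n | i \in R} => u (val i)].

(* tr_{~: R}: x has matrix entries indexed by families u, v; one sums over the
   pairs that agree outside R and have prescribed restrictions to R. *)
Definition ptrace (K : realType) (R : {set 'I_n}) (x : 'M[K[i]]_dim_full) :
    'M[K[i]]_(dim_sub R) :=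
  \matrix_(s, t)
    \sum_(u : full_basis | restr R u == enum_val s)
    \sum_(v : full_basis | (restr R v == enum_val t) &&
                       (restr (~: R) u == restr (~: R) v))
      x (enum_rank u) (enum_rank v).

Lemma restr_inj (R : {set 'I_n}) (u v : full_basis) :
  restr R u = restr R v -> restr (~: R) u = restr (~: R) v -> u = v.
Proof.
move=> /ffunP uvR /ffunP uvC; apply/ffunP => i.
have [iR|iR] := boolP (i \in R).
  by have := uvR (Sub i iR); rewrite !ffunE.
have {}iR : i \in ~: R by rewrite finset.in_setC.
by have := uvC (Sub i iR); rewrite !ffunE.
Qed.

Lemma mxtrace_ptrace (K : realType) (R : {set 'I_n}) (x : 'M[K[i]]_dim_full) :
  \tr (ptrace R x) = \tr x.
Proof.
rewrite /mxtrace (reindex_onto enum_rank enum_val) => [|i _]; last first.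
  by rewrite enum_valK.
rewrite [RHS](reindex_onto enum_rank enum_val) => [|i _]; last first.
  by rewrite enum_valK.
rewrite [RHS](partition_big (restr R) predT) //=.
apply: eq_big => [s|s _]; first by rewrite enum_rankK eqxx.
rewrite mxE enum_rankK; apply: eq_big => [u|u /eqP uE].
  by rewrite enum_rankK eqxx.
rewrite (big_pred1 u) // => v /=; apply/andP/eqP => [[/eqP vE /eqP uv]|->].
  by apply: (@restr_inj R); rewrite ?uE ?vE ?uv.
by rewrite uE !eqxx.
Qed.

End Composite.

Definition Omega (K : realType) (dA dR : nat) : K :=
  if dA == 2 then Num.min 4 (2 * dR%:R - 1)
  else Num.min (2 * Num.sqrt 2 * dA%:R) (2 * dR%:R - 1).

(* Main.v *)
(* Fix a measurement of the systems in [Q] and let [M_z] be the induced effects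
   on [A]; measuring moreover [R] refines them to [M_zy].  Extending [Q] by
   blocks of [r] systems as long as some measurement of such a block lowers the
   total entropy of the [M_z] by more than [dA ln dA r / q] uses at most [q]
   systems, after which every measurement of every disjoint [R] gains at most
   this much.  A Pinsker inequality for [M_zy] against a multiple of [M_z] then
   bounds the difference of the two channels against any family of contractions
   on [A] paired with a measurement on [R].

   To pass to the diamond norm, one writes the value of the difference on a pure
   state as a pairing with a block operator [Z].  Decomposing the blocks of [Z]
   into positive operators costs a factor [2 dA]; measuring [R] in the standard
   basis and in random phase vectors costs [1 + 2 (d_R - 1)]. *)

(* The effects [M_z] are kept unnormalised, with total trace [dA]; this is where the factor [dA] of
   the bound comes from. The state prepared at outcome [z] is the conditional state of [R] when the
   channel is fed the maximally mixed state. With this choice the multiple of [M_z] that [M_zy] is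
   compared with is exactly the one of equal trace, as Pinsker requires.

   The entropy argument controls only tests in which [R] is measured and the outcome selects a
   contraction on [A]. The obstacle is that the diamond norm also allows observables that are
   entangled between [R] and an arbitrary ancilla. Compressing such an observable by the slices of
   the input vector removes the ancilla and leaves blocks [Z t s] on [R], whose bounds do not depend
   on the dimension of the ancilla. These blocks are bounded in two independent ways, which produces
   the two entries of the minimum in [Omega]. *)
Require Import Defs.
From HB Require Import structures.
From mathcomp Require Import all_boot all_order all_algebra.
From mathcomp Require Import complex mxtens.
From mathcomp Require Import all_classical all_reals all_analysis.
From mathcomp Require Import zify ring lra.

Set Implicit Arguments.
Unset Strict Implicit.
Unset Printing Implicit Defensive.

Import Order.TTheory GRing.Theory Num.Theory.
Import numFieldNormedType.Exports.
Local Open Scope ring_scope.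
Local Open Scope sesquilinear_scope.

(** * The scalar inequality behind Pinsker *)

Section ScalarInequality.
Local Open Scope classical_set_scope.
Local Open Scope ring_scope.
Variable K : realType.
Implicit Types u x y : K.

(* The rational function [(5 u^2 - 4 u - 1) / (2 u^2 + 4 u)] agrees with [ln]
   to third order at [1], which is what makes the derivative a perfect cube. *)
Let excess u : K :=
  ln u - (5 * u ^+ 2 - 4 * u - 1) * (2 * u ^+ 2 + 4 * u)^-1.

Let is_derive_excess u : 0 < u ->
  is_derive u 1 excess ((u - 1) ^+ 3 / (u ^+ 2 * (u + 2) ^+ 2)).
Proof.
move=> u0; rewrite /excess.
have h0 : 2 * u ^+ 2 + 4 * u != 0 by rewrite gt_eqF //; nra.
have h := is_derive1_ln u0.
have hV := @is_deriveV K (fun v : K => 2 * v ^+ 2 + 4 * v) u 1 _ h0 _.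
apply: is_derive_eq.
rewrite /GRing.scale /=.
have h1 : u + 2 != 0 by rewrite gt_eqF //; lra.
have h2 : u != 0 by rewrite gt_eqF.
by field; apply/and3P.
Qed.

(** The derivative has the sign of [u - 1], so [excess] attains its minimum at [1], where it
    vanishes; the mean value theorem is applied on either side of [1]. *)
Let excess_ge0 u : 0 < u -> 0 <= excess u.
Proof.
move=> u0; have e1 : excess 1 = 0.
  by rewrite /excess ln1 expr1n !mulr1 (_ : 5 - 4 - 1 = 0 :> K) ?mul0r ?subrr; last lra.
have cont (a b : K) : 0 < a -> {within `[a, b], continuous excess}.
  move=> a0; apply: derivable_within_continuous => v.
  rewrite in_itv /= => /andP[av _]; apply: ex_derive.
  exact/is_derive_excess/(lt_le_trans a0).
have der (a b v : K) : 0 < a -> v \in `]a, b[ ->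
    is_derive v 1 excess ((v - 1) ^+ 3 / (v ^+ 2 * (v + 2) ^+ 2)).
  move=> a0; rewrite in_itv /= => /andP[av _].
  exact/is_derive_excess/(lt_trans a0).
have den0 (c : K) : 0 < c -> 0 <= (c ^+ 2 * (c + 2) ^+ 2)^-1.
  by move=> c0; rewrite invr_ge0; apply: mulr_ge0; apply: sqr_ge0.
have [u1|u1] := leP 1 u.
  have [c] := MVT_segment u1 (fun v => @der 1 u v ltr01) (@cont 1 u ltr01).
  rewrite in_itv /= => /andP[c1 cu]; rewrite e1 subr0 => ->.
  apply: mulr_ge0; last lra.
  by apply: mulr_ge0; [apply: exprn_ge0; lra | apply: den0; lra].
have [c] := MVT_segment (ltW u1) (fun v => @der u 1 v u0) (@cont u 1 u0).
rewrite in_itv /= => /andP[c1 cu]; rewrite e1 sub0r => e.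
rewrite -oppr_le0 e; apply: mulr_le0_ge0; last lra.
apply: mulr_le0_ge0; last by apply: den0; lra.
by rewrite exprS; apply: mulr_le0_ge0; [lra | apply: sqr_ge0].
Qed.

(** One term of the Kullback-Leibler divergence; the linear correction [- x + y] makes each single
    term nonnegative. As [ln 0 = 0] here, [kl x 0] is meaningful only for [x = 0], which explains
    the recurring hypothesis [y = 0 -> x = 0]. *)
Definition kl x y : K := x * (ln x - ln y) - x + y.

(** This is [excess (x / y) >= 0] with denominators cleared. The weight [x + 2 * y] has total [3]
    when [x] and [y] both have total [1], which gives Pinsker its sharp constant. *)
Lemma kl_lower_bound x y : 0 <= x -> 0 <= y -> (y = 0 -> x = 0) ->
  3 / 2 * (x - y) ^+ 2 <= (x + 2 * y) * kl x y.
Proof.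
rewrite le_eqVlt => /predU1P[<- y0 _|x0]; first by rewrite /kl; nra.
rewrite le_eqVlt => /predU1P[<- /(_ erefl) x0'|y0 _].
  by rewrite x0' ltxx in x0.
have u0 : 0 < x / y by rewrite divr_gt0.
have := excess_ge0 u0; rewrite /excess ln_div ?posrE // subr_ge0 => h.
rewrite /kl; set l := ln x - ln y in h *.
have {}h : (5 * x ^+ 2 - 4 * x * y - y ^+ 2) / (2 * x * (x + 2 * y)) <= l.
  apply: le_trans h; rewrite le_eqVlt; apply/orP; left; apply/eqP.
  have h1 : x + 2 * y != 0 by rewrite gt_eqF //; lra.
  have h2 : y != 0 by rewrite gt_eqF.
  have h3 : x != 0 by rewrite gt_eqF.
  have h4 : 2 * x ^+ 2 + 4 * x * y != 0 by rewrite gt_eqF //; nra.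
  by field; apply/and4P.
rewrite ler_pdivrMr in h; last by nra.
by nra.
Qed.

(** Arithmetic-geometric mean applied to [kl_lower_bound]. In use, [a] is the size of an entry of a
    contraction and [b] that of an overlap of eigenvectors, so [b ^+ 2] becomes the weight of the
    divergence term. *)
Lemma weighted_pinsker_term (a b x y theta : K) :
  0 <= x -> 0 <= y -> (y = 0 -> x = 0) -> 0 < theta ->
  a * b * `|x - y| <= theta / 6 * (a ^+ 2 * (x + 2 * y)) + b ^+ 2 * kl x y / theta.
Proof.
move=> x0 y0 yx t0; have := kl_lower_bound x0 y0 yx.
have : 0 <= x + 2 * y by lra.
rewrite le_eqVlt => /predU1P[e|].
  have -> : x = 0 by lra.
  have -> : y = 0 by lra.
  by rewrite /kl subrr normr0; lra.
set s := x + 2 * y => s0; set k := kl x y => hk.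
have {}hk : 3 / 2 * (x - y) ^+ 2 / s <= k by rewrite ler_pdivrMr // [k * s]mulrC.
have h2 : b ^+ 2 * (3 / 2 * (x - y) ^+ 2 / s) / theta <= b ^+ 2 * k / theta.
  by rewrite ler_pM2r ?invr_gt0 //; apply: ler_wpM2l => //; apply: sqr_ge0.
apply: le_trans (lerD (lexx _) h2).
rewrite -[(x - y) ^+ 2]real_normK ?num_real //; set z := `|x - y|.
rewrite -subr_ge0 (_ : _ - _ = theta * s / 6 * (a - 3 * b * z / (s * theta)) ^+ 2).
  by rewrite mulr_ge0 ?sqr_ge0 // divr_ge0 // mulr_ge0 // ltW.
by field; rewrite !gt_eqF.
Qed.

End ScalarInequality.

(** * Quadratic forms, positive matrices and their spectra *)

Section ClosedFieldMatrices.
Variable C : numClosedFieldType.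

Lemma trmxC_mul m n p (A : 'M[C]_(m, n)) (B : 'M[C]_(n, p)) :
  (A *m B)^t* = B^t* *m A^t*.
Proof. by rewrite trmx_mul map_mxM. Qed.

Lemma trmxC_add m n (A B : 'M[C]_(m, n)) : (A + B)^t* = A^t* + B^t*.
Proof. by rewrite linearD /= map_mxD. Qed.

Lemma trmxC_scale m n (a : C) (A : 'M[C]_(m, n)) : (a *: A)^t* = a^* *: A^t*.
Proof. by rewrite linearZ /= map_mxZ. Qed.

Lemma trmxC_opp m n (A : 'M[C]_(m, n)) : (- A)^t* = - A^t*.
Proof. by rewrite linearN /= map_mxN. Qed.

Lemma trmxC_sum m n (I : Type) (r : seq I) (P : pred I) (F : I -> 'M[C]_(m, n)) :
  (\sum_(i <- r | P i) F i)^t* = \sum_(i <- r | P i) (F i)^t*.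
Proof.
apply: (big_morph (fun A : 'M[C]_(m, n) => A^t* )) => [X Y|].
  exact: trmxC_add.
by rewrite trmx0 map_mx0.
Qed.

Lemma trmxC1 n : (1%:M : 'M[C]_n)^t* = 1%:M.
Proof. by rewrite trmx1 map_mx1. Qed.

Lemma trmxC_diag n (D : 'rV[C]_n) : (diag_mx D)^t* = diag_mx (map_mx Num.conj D).
Proof. by rewrite tr_diag_mx map_diag_mx. Qed.

Lemma mxtrace_trmxC n (A : 'M[C]_n) : \tr (A^t* ) = (\tr A)^*.
Proof. by rewrite /mxtrace rmorph_sum; apply: eq_bigr => i _; rewrite !mxE. Qed.

Lemma addmxE m n (A B : 'M[C]_(m, n)) i j : (A + B) i j = A i j + B i j.
Proof. by rewrite mxE. Qed.

Lemma oppmxE m n (A : 'M[C]_(m, n)) i j : (- A) i j = - A i j.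
Proof. by rewrite mxE. Qed.

Lemma scalemxE m n a (A : 'M[C]_(m, n)) i j : (a *: A) i j = a * A i j.
Proof. by rewrite mxE. Qed.

Lemma hermP n (A : 'M[C]_n) : A \is hermsymmx <-> A^t* = A.
Proof.
split=> [/is_hermitianmxP|h]; first by rewrite expr0 scale1r => <-.
by apply/is_hermitianmxP; rewrite expr0 scale1r h.
Qed.

Definition quad n (A : 'M[C]_n) (v : 'cV[C]_n) : C := (v^t* *m A *m v) 0 0.

Definition psd n (A : 'M[C]_n) : Prop := forall v, 0 <= quad A v.

Lemma quadD n (A B : 'M[C]_n) v : quad (A + B) v = quad A v + quad B v.
Proof. by rewrite /quad mulmxDr mulmxDl mxE. Qed.

Lemma quadZ n a (A : 'M[C]_n) v : quad (a *: A) v = a * quad A v.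
Proof. by rewrite /quad -scalemxAr -scalemxAl mxE. Qed.

Lemma quadN n (A : 'M[C]_n) v : quad (- A) v = - quad A v.
Proof. by rewrite -scaleN1r quadZ mulN1r. Qed.

Lemma quadE n (A : 'M[C]_n) v :
  quad A v = \sum_i \sum_j (v i 0)^* * A i j * v j 0.
Proof.
rewrite /quad mxE exchange_big; apply: eq_bigr => j _.
by rewrite mxE mulr_suml; apply: eq_bigr => i _; rewrite !mxE.
Qed.

Lemma quad_tr n (A : 'M[C]_n) v : quad A v = \tr (A *m (v *m v^t*)).
Proof. by rewrite mulmxA mxtrace_mulC mulmxA /mxtrace big_ord1. Qed.

Lemma quad1 n (v : 'cV[C]_n) : quad 1%:M v = \sum_i `|v i 0| ^+ 2.
Proof.
by rewrite /quad mulmx1 mxE; apply: eq_bigr => i _; rewrite !mxE normCKC.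
Qed.

Lemma quad_gram n m (B : 'M[C]_(m, n)) v : quad (B^t* *m B) v = quad 1%:M (B *m v).
Proof. by rewrite /quad mulmx1 trmxC_mul !mulmxA. Qed.

Lemma quad_delta n (A : 'M[C]_n) k : quad A (delta_mx k 0) = A k k.
Proof.
rewrite /quad trmx_delta map_delta_mx -rowE mxE (bigD1 k) //= big1 ?addr0.
  by rewrite !mxE !eqxx mulr1.
by move=> m /negbTE ml; rewrite !mxE ml mulr0.
Qed.

(** Polarization: the vectors [e i + a *: e j] with [a = 1] and [a = 'i] give the sum and the
    difference of [A i j] and [A j i]. *)
Lemma quad_eq0 n (A : 'M[C]_n) : (forall v, quad A v = 0) -> A = 0.
Proof.
move=> h; apply/matrixP => i j; rewrite mxE.
pose e k : 'cV[C]_n := delta_mx k 0.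
have B k l a : quad A (e k + a *: e l) =
    quad A (e k) + a^* * a * quad A (e l) + a * A k l + a^* * A l k.
  have eb p q : ((e p)^t* *m A *m e q) 0 0 = A p q.
    rewrite trmx_delta map_delta_mx -rowE mxE (bigD1 q) //= big1 ?addr0.
      by rewrite !mxE !eqxx mulr1.
    by move=> m /negbTE ml; rewrite !mxE ml mulr0.
  rewrite /quad trmxC_add trmxC_scale (mulmxDl _ _ A) mulmxDl !mulmxDr.
  rewrite -!scalemxAr -!scalemxAl.
  have aE (X Y : 'M[C]_1) : (X + Y) 0 0 = X 0 0 + Y 0 0 by rewrite mxE.
  have sE c (X : 'M[C]_1) : (c *: X) 0 0 = c * X 0 0 by rewrite mxE.
  by rewrite !aE !sE !eb; ring.
have := B i j 1; rewrite !h rmorph1 !mul1r !add0r => /esym h1.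
have := B i j 'i; rewrite !h conjCi !mulr0 !add0r mulNr -mulrBr => /esym/eqP.
rewrite mulf_eq0 (negbTE (neq0Ci _)) subr_eq0 => /eqP h2.
by move/eqP: h1; rewrite -h2 -mulr2n mulrn_eq0 => /eqP.
Qed.

Lemma quad_trmxC n (A : 'M[C]_n) v : quad (A^t*) v = (quad A v)^*.
Proof.
rewrite /quad; transitivity (((v^t* *m A *m v)^t*) 0 0); last by rewrite !mxE.
by rewrite !trmxC_mul trmxCK mulmxA.
Qed.

(** The form of [A^t* - A] vanishes identically, so [quad_eq0] applies. *)
Lemma real_quad_herm n (A : 'M[C]_n) :
  (forall v, quad A v \is Num.real) -> A^t* = A.
Proof.
move=> h; apply/eqP; rewrite -subr_eq0; apply/eqP/quad_eq0 => v.
by rewrite quadD quadN quad_trmxC (CrealP (h v)) subrr.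
Qed.

Lemma psd_herm n (A : 'M[C]_n) : psd A -> A^t* = A.
Proof. by move=> h; apply: real_quad_herm => v; apply/ger0_real/h. Qed.

Lemma psdD n (A B : 'M[C]_n) : psd A -> psd B -> psd (A + B).
Proof. by move=> hA hB v; rewrite quadD addr_ge0. Qed.

Lemma psd0 n : psd (0 : 'M[C]_n).
Proof. by move=> v; rewrite /quad mulmx0 mul0mx mxE. Qed.

Lemma psd_sum (I : Type) (r : seq I) (P : pred I) n (F : I -> 'M[C]_n) :
  (forall i, P i -> psd (F i)) -> psd (\sum_(i <- r | P i) F i).
Proof. by move=> h; apply: big_ind => //; [apply: psd0 | apply: psdD]. Qed.

Lemma psdZ n (a : C) (A : 'M[C]_n) : 0 <= a -> psd A -> psd (a *: A).
Proof. by move=> a0 hA v; rewrite quadZ mulr_ge0. Qed.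

Lemma quad1_ge0 n (v : 'cV[C]_n) : 0 <= quad 1%:M v.
Proof. by rewrite quad1 sumr_ge0 // => i _; rewrite exprn_ge0. Qed.

Lemma psd_gram m n (B : 'M[C]_(m, n)) : psd (B^t* *m B).
Proof. by move=> v; rewrite quad_gram quad1_ge0. Qed.

Lemma psd_gramC m n (B : 'M[C]_(n, m)) : psd (B *m B^t*).
Proof. by rewrite -{1}[B]trmxCK; apply: psd_gram. Qed.

Lemma psd_conj m n (A : 'M[C]_m) (B : 'M[C]_(m, n)) :
  psd A -> psd (B^t* *m A *m B).
Proof. by move=> hA v; have := hA (B *m v); rewrite /quad trmxC_mul !mulmxA. Qed.

Lemma psd1 n : psd (1%:M : 'M[C]_n).
Proof. exact: quad1_ge0. Qed.

Lemma unitary_mulVmx n (U : 'M[C]_n) : U \is unitarymx -> U^t* *m U = 1%:M.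
Proof. by move=> h; rewrite -invmx_unitary // mulVmx // unitarymx_unit. Qed.

Lemma herm_spectral n (A : 'M[C]_n) : A^t* = A ->
  A = (spectralmx A)^t* *m diag_mx (spectral_diag A) *m spectralmx A.
Proof.
move=> /hermP hA; have /orthomx_spectralP {1}-> := hermitian_normalmx hA.
by rewrite invmx_unitary ?spectral_unitarymx.
Qed.

Lemma spectral_diag_herm n (A : 'M[C]_n) : A^t* = A ->
  spectralmx A *m A *m (spectralmx A)^t* = diag_mx (spectral_diag A).
Proof.
move=> hA; rewrite [X in _ *m X *m _](herm_spectral hA) !mulmxA.
rewrite (unitarymxP (spectral_unitarymx A)) mul1mx -mulmxA.
by rewrite (unitarymxP (spectral_unitarymx A)) mulmx1.
Qed.

Lemma spectral_diag_real n (A : 'M[C]_n) i : A^t* = A ->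
  spectral_diag A 0 i \is Num.real.
Proof. by move=> /hermP /hermitian_spectral_diag_real /mxOverP. Qed.

Lemma spectral_diag_ge0 n (A : 'M[C]_n) i : psd A -> 0 <= spectral_diag A 0 i.
Proof.
move=> hA; have /(_ (delta_mx i 0)) := psd_conj ((spectralmx A)^t* ) hA.
rewrite trmxCK spectral_diag_herm ?psd_herm // quad_delta.
by rewrite mxE eqxx mulr1n.
Qed.

Lemma mxtrace_spectral n (A : 'M[C]_n) : A^t* = A ->
  \tr A = \sum_i spectral_diag A 0 i.
Proof.
move=> hA; rewrite -[A in LHS]mul1mx -(unitary_mulVmx (spectral_unitarymx A)).
by rewrite -mulmxA mxtrace_mulC spectral_diag_herm // mxtrace_diag.
Qed.

Lemma psd_factor n (A : 'M[C]_n) : psd A -> exists B : 'M[C]_n, A = B^t* *m B.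
Proof.
move=> hA; exists (diag_mx (\row_i sqrtC (spectral_diag A 0 i)) *m spectralmx A).
rewrite trmxC_mul trmxC_diag !mulmxA -[_ *m diag_mx _ *m diag_mx _]mulmxA.
rewrite mulmx_diag {1}(herm_spectral (psd_herm hA)); congr (_ *m diag_mx _ *m _).
apply/rowP => i; rewrite !mxE geC0_conj ?sqrtC_ge0 ?spectral_diag_ge0 //.
by rewrite -expr2 sqrtCK.
Qed.

Lemma psd_mxtrace_ge0 n (A : 'M[C]_n) : psd A -> 0 <= \tr A.
Proof.
move=> hA; rewrite mxtrace_spectral ?psd_herm //.
by apply: sumr_ge0 => i _; apply: spectral_diag_ge0.
Qed.

Lemma psd_mxtrace_mul_ge0 n (A B : 'M[C]_n) : psd A -> psd B -> 0 <= \tr (A *m B).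
Proof.
move=> /psd_factor[D ->] hB; rewrite -(mulmxA (D^t* )) mxtrace_mulC.
by have /psd_mxtrace_ge0 := psd_conj (D^t* ) hB; rewrite trmxCK.
Qed.

Lemma psd_mul_comm n (A B D : 'M[C]_n) :
  psd A -> B = D^t* *m D -> A *m D^t* = D^t* *m A -> psd (A *m B).
Proof. by move=> hA -> e; rewrite mulmxA e; apply: psd_conj. Qed.

Lemma herm_psd_diff n (A : 'M[C]_n) : A^t* = A ->
  exists P N : 'M[C]_n, [/\ psd P, psd N & A = P - N].
Proof.
(* The identity [4 A = (1 + A)^2 - (1 - A)^2], both squares being Gram matrices. *)
move=> hA; exists (4^-1 *: ((1%:M + A)^t* *m (1%:M + A))).
exists (4^-1 *: ((1%:M - A)^t* *m (1%:M - A))).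
have h4 : 0 <= 4^-1 :> C by rewrite invr_ge0 ler0n.
split; try by apply: psdZ => //; apply: psd_gram.
rewrite !trmxC_add trmxC_opp trmxC1 hA -scalerBr.
rewrite !(mulmxDl, mulmxDr, mul1mx, mulmx1, mulNmx, mulmxN, opprD, opprK).
move: (A *m A) => X; apply/matrixP => i j; rewrite !mxE.
move: (X i j) (A i j) (i == j)%:R => x a b; by field.
Qed.

Lemma herm_decomp n (A : 'M[C]_n) :
  exists X Y : 'M[C]_n, [/\ X^t* = X, Y^t* = Y & A = X + 'i *: Y].
Proof.
exists (2^-1 *: (A + A^t*)), ((2^-1 * - 'i) *: (A - A^t*)).
have c2 : (2^-1 : C)^* = 2^-1 by rewrite fmorphV rmorph_nat.
split.
- by rewrite trmxC_scale trmxC_add trmxCK addrC c2.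
- have -> : (2^-1 * - 'i : C) = - (2^-1 * 'i) by rewrite mulrN.
  rewrite trmxC_scale rmorphN rmorphM /= conjCi c2 mulrN opprK.
  by rewrite trmxC_add trmxC_opp trmxCK scaleNr -scalerN opprB.
- apply/matrixP => i j; rewrite !mxE; move: (A i j) ((A j i)^* ) => a b.
  have -> : 'i * (2^-1 * - 'i * (a - b)) = - 'i ^+ 2 * (2^-1 * (a - b)) by ring.
  by rewrite sqrCi; field.
Qed.

Lemma herm_combination n (a : C) (X Y : 'M[C]_n) : X^t* = X -> Y^t* = Y ->
  (X + a *: Y)^t* = X + a^* *: Y.
Proof. by move=> hX hY; rewrite trmxC_add trmxC_scale hX hY. Qed.

Lemma sum_cauchy_schwarz n (x y : 'I_n -> C) :
  `|\sum_i x i * y i| ^+ 2 <= (\sum_i `|x i| ^+ 2) * (\sum_i `|y i| ^+ 2).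
Proof.
have dotE (a c : 'I_n -> C) :
    dotmx (\row_i a i) (\row_i c i) = \sum_i a i * (c i)^*.
  by rewrite dotmxE mxE; apply: eq_bigr => i _; rewrite !mxE.
pose u : 'rV[C]_n := \row_i x i; pose v : 'rV[C]_n := \row_i (y i)^*.
have : `|dotmx u v| ^+ 2 <= dotmx u u * dotmx v v.
  exact: (CauchySchwarz (@dotmx C n) u v).1.
rewrite !dotE; congr (`|_| ^+ 2 <= _ * _); apply: eq_bigr => i _.
- by rewrite conjCK.
- by rewrite normCK.
- by rewrite conjCK normCKC.
Qed.

(** For [P = B^t* *m B] the trace is the sum of the squared entries of [B], and Cauchy-Schwarz
    bounds each coordinate of [B *m v]. *)
Lemma quad_le_trace n (P : 'M[C]_n) v : psd P -> quad P v <= quad 1%:M v * \tr P.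
Proof.
move=> /psd_factor[B ->]; rewrite quad_gram !quad1.
have -> : \tr (B^t* *m B) = \sum_i \sum_j `|B i j| ^+ 2.
  rewrite /mxtrace exchange_big; apply: eq_bigr => j _; rewrite mxE.
  by apply: eq_bigr => i _; rewrite !mxE normCKC.
rewrite mulr_sumr; apply: ler_sum => i _; rewrite mxE mulrC.
exact: sum_cauchy_schwarz.
Qed.

End ClosedFieldMatrices.

Lemma big_option (V : nmodType) (J : finType) (F : option J -> V) :
  \sum_o F o = F None + \sum_y F (Some y).
Proof.
rewrite (bigD1 None) //=; congr (_ + _).
rewrite (reindex_omap Some id) => [|[]] //.
by apply: eq_bigl => y; rewrite /= eqxx.
Qed.

(** * Real parts and real eigenvalues *)

Section ComplexNumbers.
Variable K : realType.
Local Notation C := K[i].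
Local Notation re := (@complex.Re K).
Local Notation normc := (@Normc.normc K).
Local Notation "x %:C" := (real_complex K x) : ring_scope.

Lemma reD (x y : C) : re (x + y) = re x + re y.
Proof. by case: x y => a b [c d]. Qed.

Lemma reN (x : C) : re (- x) = - re x.
Proof. by case: x. Qed.

Lemma reB (x y : C) : re (x - y) = re x - re y.
Proof. by rewrite reD reN. Qed.

Lemma re_sum (I : Type) (r : seq I) (P : pred I) (F : I -> C) :
  re (\sum_(i <- r | P i) F i) = \sum_(i <- r | P i) re (F i).
Proof. exact: (big_morph re reD). Qed.

Lemma reMl (a : K) (x : C) : re (a%:C * x) = a * re x.
Proof. by case: x => b c /=; rewrite mul0r subr0. Qed.

Lemma re_le_normc (x : C) : re x <= normc x.
Proof.
have := normc_ge_Re x; rewrite -[`|x|]/((normc x)%:C) lecR.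
exact/le_trans/ler_norm.
Qed.

Lemma normc_real (a : K) : normc a%:C = `|a|.
Proof. by rewrite /= expr0n /= addr0 sqrtr_sqr. Qed.

Lemma mul_conjc (x : C) : x * x^* = (normc x ^+ 2)%:C.
Proof. by rewrite -normCK rmorphXn. Qed.

Lemma ge0_reE (x : C) : 0 <= x -> x = (re x)%:C.
Proof. by move=> x0; rewrite RRe_real // ger0_real. Qed.

Lemma le_re (x y : C) : x <= y -> re x <= re y.
Proof. by rewrite lecE => /andP[]. Qed.

Lemma ge0_re (x : C) : 0 <= x -> 0 <= re x.
Proof. exact: le_re. Qed.

Lemma psdmxP n (A : 'M[C]_n) : psdmx A <-> psd A.
Proof. by split=> [[]//|h]; split=> //; apply/hermP/psd_herm. Qed.

Definition eigval n (A : 'M[C]_n) (i : 'I_n) : K := re (spectral_diag A 0 i).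

Lemma eigvalE n (A : 'M[C]_n) i : A^t* = A -> spectral_diag A 0 i = (eigval A i)%:C.
Proof. by move=> hA; rewrite /eigval RRe_real // spectral_diag_real. Qed.

Lemma eigval_ge0 n (A : 'M[C]_n) i : psd A -> 0 <= eigval A i.
Proof. by move=> hA; apply/ge0_re/spectral_diag_ge0. Qed.

Lemma sum_eigval n (A : 'M[C]_n) : A^t* = A -> \sum_i eigval A i = re (\tr A).
Proof. by move=> hA; rewrite mxtrace_spectral // re_sum. Qed.

End ComplexNumbers.

Section Contraction.
Variable C : numClosedFieldType.

(** Operator norm at most one, stated on both sides so that columns and rows alike have square sum
    at most one. *)
Definition contraction n (f : 'M[C]_n) : Prop :=
  psd (1%:M - f^t* *m f) /\ psd (1%:M - f *m f^t*).

Lemma contraction_unitary n (U f : 'M[C]_n) (V : 'M[C]_n) :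
  U \is unitarymx -> V \is unitarymx -> contraction f -> contraction (V *m f *m U^t*).
Proof.
move=> hU hV [h1 h2].
have eU := unitarymxP hU; have eV := unitarymxP hV.
have eV' := unitary_mulVmx hV; have eU' := unitary_mulVmx hU.
split.
  have := psd_conj (U^t* ) h1; rewrite trmxCK mulmxBr mulmxBl mulmx1 eU.
  rewrite !trmxC_mul trmxCK !mulmxA -[_ *m V^t* *m V]mulmxA eV' mulmx1.
  by rewrite -!mulmxA.
have := psd_conj (V^t* ) h2; rewrite trmxCK mulmxBr mulmxBl mulmx1 eV.
rewrite !trmxC_mul trmxCK !mulmxA -[_ *m U^t* *m U]mulmxA eU' mulmx1.
by rewrite -!mulmxA.
Qed.

End Contraction.

(** * Entropy of unnormalised positive operators *)

Section Entropy.
Variable K : realType.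
Local Notation C := K[i].
Local Notation re := (@complex.Re K).
Local Notation normc := (@Normc.normc K).
Local Notation "x %:C" := (real_complex K x) : ring_scope.

Lemma unitary_row_sum n (W : 'M[C]_n) i : W \is unitarymx ->
  \sum_j normc (W i j) ^+ 2 = 1.
Proof.
move=> /unitarymxP /matrixP /(_ i i); rewrite !mxE eqxx => /(congr1 re) /= <-.
by rewrite re_sum; apply: eq_bigr => j _; rewrite !mxE mul_conjc.
Qed.

Lemma unitary_col_sum n (W : 'M[C]_n) j : W \is unitarymx ->
  \sum_i normc (W i j) ^+ 2 = 1.
Proof.
move=> /unitary_mulVmx /matrixP /(_ j j); rewrite !mxE eqxx => /(congr1 re) /= <-.
by rewrite re_sum; apply: eq_bigr => i _; rewrite !mxE mulrC mul_conjc.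
Qed.

Lemma contraction_row_sum n (f : 'M[C]_n) i : contraction f ->
  \sum_j normc (f i j) ^+ 2 <= 1.
Proof.
case=> _ /(_ (delta_mx i 0)) /ge0_re.
rewrite quad_delta 4!mxE eqxx reB subr_ge0 re_sum; apply: le_trans.
by apply: ler_sum => j _; rewrite !mxE mul_conjc.
Qed.

Lemma contraction_col_sum n (f : 'M[C]_n) j : contraction f ->
  \sum_i normc (f i j) ^+ 2 <= 1.
Proof.
case=> /(_ (delta_mx j 0)) /ge0_re + _.
rewrite quad_delta 4!mxE eqxx reB subr_ge0 re_sum; apply: le_trans.
by apply: ler_sum => i _; rewrite !mxE mulrC mul_conjc.
Qed.

Definition xlnx (x : K) : K := x * ln x.

(* The trace of [A] times the von Neumann entropy of [A / \tr A]. *)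
Definition entropy n (A : 'M[C]_n) : K :=
  xlnx (re (\tr A)) - \sum_i xlnx (eigval A i).

(* Relative entropy of [A] with respect to [(\tr A / \tr B) *: B], written in
   an eigenbasis of [B]. *)
Definition relative_entropy n (A B : 'M[C]_n) : K :=
  \sum_i xlnx (eigval A i)
  - \sum_j re ((spectralmx B *m A *m (spectralmx B)^t*) j j) * ln (eigval B j)
  - xlnx (re (\tr A)) + re (\tr A) * ln (re (\tr B)).

Lemma entropy_ge0 n (A : 'M[C]_n) : psd A -> 0 <= entropy A.
Proof.
move=> hA; rewrite /entropy {1}/xlnx -(sum_eigval (psd_herm hA)) mulr_suml -sumrB.
apply: sumr_ge0 => i _; rewrite /xlnx -mulrBr; have := eigval_ge0 i hA.
rewrite le_eqVlt => /predU1P[<-|l0]; first by rewrite mul0r.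
have le : eigval A i <= \sum_j eigval A j.
  rewrite (bigD1 i) //= lerDl; apply: sumr_ge0 => j _; exact: eigval_ge0.
apply: mulr_ge0; first exact: ltW.
by rewrite subr_ge0 ler_ln ?posrE // (lt_le_trans l0).
Qed.

Lemma eigval1 n (i : 'I_n) : eigval (1%:M : 'M[C]_n) i = 1.
Proof.
have := spectral_diag_herm (@trmxC1 C n).
rewrite mulmx1 (unitarymxP (spectral_unitarymx _)) => /matrixP /(_ i i).
by rewrite !mxE eqxx !mulr1n /eigval => <-.
Qed.

Lemma entropy1 n : entropy (1%:M : 'M[C]_n) = n%:R * ln n%:R.
Proof.
rewrite /entropy mxtrace1 -(rmorph_nat (real_complex K)) /=.
rewrite [X in _ - X]big1 ?subr0 // => i _.
by rewrite eigval1 /xlnx ln1 mulr0.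
Qed.

(** The cross term is linear in [A y] and always taken in the eigenbasis of [B], so summing over [y]
    turns it into the spectral sum of [B]. The right-hand side is the Holevo information of the
    ensemble, the quantity that saturation bounds. *)
Lemma sum_relative_entropy n (I : finType) (A : I -> 'M[C]_n) (B : 'M[C]_n) :
  B^t* = B -> \sum_y A y = B ->
  \sum_y relative_entropy (A y) B = entropy B - \sum_y entropy (A y).
Proof.
move=> hB AB; rewrite /relative_entropy /entropy.
rewrite !(big_split, sumrN) /= opprB.
have -> : \sum_y re (\tr (A y)) * ln (re (\tr B)) = xlnx (re (\tr B)).
  by rewrite -mulr_suml -re_sum -raddf_sum /= AB.
suff -> : \sum_y \sum_j
    re ((spectralmx B *m A y *m (spectralmx B)^t*) j j) * ln (eigval B j) =
    \sum_j xlnx (eigval B j) by ring.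
rewrite exchange_big; apply: eq_bigr => j _; rewrite -mulr_suml -re_sum.
congr (_ * _); rewrite -summxE -mulmx_suml -mulmx_sumr AB spectral_diag_herm //.
by rewrite mxE eqxx mulr1n.
Qed.

End Entropy.

(** * The quantum Pinsker inequality *)

Section Pinsker.
Variable K : realType.
Local Notation C := K[i].
Local Notation re := (@complex.Re K).
Local Notation normc := (@Normc.normc K).
Local Notation "x %:C" := (real_complex K x) : ring_scope.

Lemma conj_diag_entry n (W : 'M[C]_n) (D : 'rV[C]_n) j :
  (W^t* *m diag_mx D *m W) j j = \sum_i (normc (W i j) ^+ 2)%:C * D 0 i.
Proof.
rewrite -mulmxA mul_diag_mx mxE; apply: eq_bigr => i _.
by rewrite !mxE mulrCA [_^* * _]mulrC mul_conjc mulrC.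
Qed.

Section OverlapExpansion.
Variables (n : nat) (A B : 'M[C]_n).
Hypotheses (hA : psd A) (hB : psd B) (hAB : psd (B - A)).

Let U := spectralmx A.
Let V := spectralmx B.
Let W := U *m V^t*.
(** Squared overlap of the [i]-th eigenvector of [A] with the [j]-th of [B]; a doubly stochastic
    matrix, [W] being unitary. *)
Let w i j : K := normc (W i j) ^+ 2.
Let l i := eigval A i.
Let mu j := eigval B j.
Let tA := re (\tr A).
Let tB := re (\tr B).
Let c := tA / tB.

Let unitaryW : W \is unitarymx.
Proof.
by apply: mul_unitarymx; rewrite ?trmxC_unitary spectral_unitarymx.
Qed.

Let l_ge0 i : 0 <= l i. Proof. exact: eigval_ge0. Qed.
Let mu_ge0 j : 0 <= mu j. Proof. exact: eigval_ge0. Qed.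
Let w_ge0 i j : 0 <= w i j. Proof. exact: sqr_ge0. Qed.
Let sum_l : \sum_i l i = tA. Proof. by rewrite sum_eigval ?psd_herm. Qed.
Let sum_mu : \sum_j mu j = tB. Proof. by rewrite sum_eigval ?psd_herm. Qed.
Let tA_ge0 : 0 <= tA. Proof. exact/ge0_re/psd_mxtrace_ge0. Qed.
Let tB_ge0 : 0 <= tB. Proof. exact/ge0_re/psd_mxtrace_ge0. Qed.
Let c_ge0 : 0 <= c. Proof. exact: divr_ge0. Qed.

Let le_tAB : tA <= tB.
Proof. by rewrite -subr_ge0 -reB -raddfB; apply/ge0_re/psd_mxtrace_ge0. Qed.

Let tA0 : tB = 0 -> tA = 0.
Proof. by move=> e; apply/eqP; rewrite eq_le tA_ge0 andbT -e. Qed.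

Let ctB : c * tB = tA.
Proof.
by rewrite /c; have [e|?] := eqVneq tB 0; [rewrite e mulr0 tA0|rewrite divfK].
Qed.

Let l0 i : tA = 0 -> l i = 0.
Proof.
move=> e; apply/eqP; rewrite eq_le l_ge0 andbT -e -sum_l (bigD1 i) //= lerDl.
exact: sumr_ge0.
Qed.

Let diagA j : re ((V *m A *m V^t*) j j) = \sum_i w i j * l i.
Proof.
rewrite (herm_spectral (psd_herm hA)) -/U.
have -> : V *m (U^t* *m diag_mx (spectral_diag A) *m U) *m V^t* =
          W^t* *m diag_mx (spectral_diag A) *m W.
  by rewrite /W trmxC_mul trmxCK !mulmxA.
rewrite conj_diag_entry re_sum; apply: eq_bigr => i _.
by rewrite eigvalE ?psd_herm // reMl.
Qed.

(** Since [A] is below [B], an eigenvector of [B] with eigenvalue zero carries no weight of [A]; and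
    [c = 0] forces [A] to have trace zero. Hence the convention [ln 0 = 0] does no harm below. *)
Let supp i j : c * mu j = 0 -> w i j * l i = 0.
Proof.
move=> /eqP; rewrite mulf_eq0 => /orP[|/eqP mu0].
  rewrite mulf_eq0 invr_eq0 => h; rewrite (_ : l i = 0) ?mulr0 //; apply: l0.
  by case/orP: h => /eqP // /tA0.
have := psd_conj (V^t*) hAB; rewrite trmxCK mulmxBr mulmxBl.
move=> /(_ (delta_mx j 0)) /ge0_re; rewrite quad_delta (spectral_diag_herm (psd_herm hB)).
rewrite addmxE oppmxE reB diagA mxE eqxx mulr1n -/(eigval B j) -/(mu j) mu0.
rewrite sub0r oppr_ge0 => le0.
apply/eqP; rewrite eq_le (mulr_ge0 (w_ge0 _ _) (l_ge0 _)) andbT.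
apply: le_trans le0; rewrite (bigD1 i) //= lerDl.
by apply: sumr_ge0 => k _; apply: mulr_ge0.
Qed.

(** The right-hand side is the classical divergence of the Nussbaum-Szkola distributions
    [w i j * l i] and [w i j * (c * mu j)]. Both have total [tA], so the linear corrections in [kl]
    cancel. *)
Lemma relative_entropy_overlap :
  relative_entropy A B = \sum_i \sum_j w i j * kl (l i) (c * mu j).
Proof.
have term i j : w i j * kl (l i) (c * mu j) =
    w i j * xlnx (l i) - w i j * l i * ln (mu j) - w i j * (l i * ln c)
    - w i j * l i + c * (w i j * mu j).
  have e : w i j * l i * ln (c * mu j) = w i j * l i * (ln c + ln (mu j)).
    have [/supp ->|nz] := eqVneq (c * mu j) 0; first by rewrite !mul0r.
    move: nz; rewrite mulf_eq0 negb_or => /andP[c0 m0].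
    by rewrite lnM // posrE lt_def ?c0 ?m0 ?c_ge0 ?mu_ge0.
  rewrite /kl /xlnx; transitivity (w i j * (l i * ln (l i)) -
    w i j * l i * ln (c * mu j) - w i j * l i + c * (w i j * mu j)); first by ring.
  by rewrite e; ring.
under eq_bigr => i _ do under eq_bigr => j _ do rewrite term.
have rowW i : \sum_j w i j = 1 by apply: unitary_row_sum.
have colW j : \sum_i w i j = 1 by apply: unitary_col_sum.
under eq_bigr => i _ do rewrite !(big_split, sumrN) /= -!mulr_suml rowW !mul1r.
rewrite !(big_split, sumrN) /= sum_l.
have -> : \sum_i \sum_j w i j * l i * ln (mu j) =
    \sum_j re ((V *m A *m V^t*) j j) * ln (mu j).
  by rewrite exchange_big; apply: eq_bigr => j _; rewrite -mulr_suml diagA.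
have -> : \sum_i \sum_j c * (w i j * mu j) = tA.
  rewrite exchange_big; under eq_bigr => j _ do rewrite -mulr_sumr -mulr_suml colW mul1r.
  by rewrite -mulr_sumr sum_mu ctB.
rewrite -mulr_suml sum_l /relative_entropy -/tA -/tB -/V.
have -> : tA * ln c = xlnx tA - tA * ln tB.
  have [->|a0] := eqVneq tA 0; first by rewrite /xlnx !mul0r subrr.
  have b0 : tB != 0 by apply: contra a0 => /eqP /tA0 ->.
  by rewrite /c ln_div ?posrE ?lt_def ?a0 ?b0 ?tA_ge0 ?tB_ge0 // /xlnx mulrBr.
ring.
Qed.

(* Quantum Pinsker inequality.  Both traces are expanded over the pairs of an
   eigenvector of [A] and an eigenvector of [B]; on each pair the scalar
   inequality applies, so that no monotonicity of relative entropy is used. *)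
Lemma pinsker (f : 'M[C]_n) (theta : K) : contraction f -> 0 < theta ->
  re (\tr (f *m (A - c%:C *: B))) <=
    theta / 2 * tA + relative_entropy A B / theta.
Proof.
move=> hf t0.
have hU : U \is unitarymx := spectral_unitarymx A.
have hV : V \is unitarymx := spectral_unitarymx B.
pose G := V *m f *m U^t*.
have hG : contraction G by apply: contraction_unitary.
have expand : \tr (f *m (A - c%:C *: B)) =
    \sum_j \sum_i G j i * W i j * (l i - c * mu j)%:C.
  have eA : f *m A = f *m (U^t* *m diag_mx (spectral_diag A) *m U).
    by rewrite -herm_spectral ?psd_herm.
  have trA : \tr (f *m A) = \sum_j \sum_i G j i * W i j * (l i)%:C.
    have -> : \tr (f *m A) = \tr (G *m diag_mx (spectral_diag A) *m W).
      rewrite -[f *m A]mulmx1 -(unitary_mulVmx hV) mulmxA mxtrace_mulC eA.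
      by rewrite /G /W !mulmxA.
    rewrite /mxtrace; apply: eq_bigr => j _; rewrite mul_mx_diag mxE.
    by apply: eq_bigr => i _; rewrite mxE eigvalE ?psd_herm // mulrAC.
  have trB : \tr (f *m B) = \sum_j \sum_i G j i * W i j * (mu j)%:C.
    have -> : \tr (f *m B) = \tr (G *m W *m diag_mx (spectral_diag B)).
      have -> : \tr (f *m B) =
          \tr (f *m (U^t* *m U) *m (V^t* *m diag_mx (spectral_diag B) *m V)).
        by rewrite (unitary_mulVmx hU) mulmx1 -(herm_spectral (psd_herm hB)).
      by rewrite (mulmxA _ _ V) mxtrace_mulC /G /W !mulmxA.
    rewrite /mxtrace; apply: eq_bigr => j _; rewrite mul_mx_diag 2!mxE mulr_suml.
    by apply: eq_bigr => i _; rewrite eigvalE ?psd_herm.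
  rewrite mulmxBr raddfB /= -scalemxAr mxtraceZ trA trB mulr_sumr -sumrB.
  apply: eq_bigr => j _; rewrite mulr_sumr -sumrB; apply: eq_bigr => i _.
  have -> : (l i - c * mu j)%:C = (l i)%:C - c%:C * (mu j)%:C :> C.
    by rewrite rmorphB rmorphM.
  by move: (l i)%:C (mu j)%:C c%:C => x y z; ring.
pose g j i := normc (G j i) ^+ 2.
have bound i j : re (G j i * W i j * (l i - c * mu j)%:C) <=
    theta / 6 * (g j i * l i) + theta / 3 * (g j i * (c * mu j)) +
    w i j * kl (l i) (c * mu j) / theta.
  have cmu0 : 0 <= c * mu j by apply: mulr_ge0.
  apply: le_trans (re_le_normc _) _; rewrite !Normc.normcM normc_real.
  (* [supp] yields [l i = 0] only where the overlap is nonzero; where it is zero, the left side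
     vanishes. *)
  have [W0|W0] := eqVneq (normc (W i j)) 0.
    rewrite /w W0 mulr0 mul0r expr0n /= !mul0r addr0.
    by apply: addr_ge0; (apply: mulr_ge0; [lra | apply: mulr_ge0 => //; exact: sqr_ge0]).
  have lz : c * mu j = 0 -> l i = 0.
    move=> /(supp i) /eqP; rewrite mulf_eq0 => /orP[|/eqP//].
    by rewrite /w sqrf_eq0 (negbTE W0).
  apply: le_trans (weighted_pinsker_term _ _ (l_ge0 i) cmu0 lz t0) _.
  by rewrite le_eqVlt; apply/orP; left; apply/eqP; rewrite /g /w; field; rewrite gt_eqF.
rewrite expand re_sum; under eq_bigr => j _ do rewrite re_sum.
apply: le_trans (ler_sum _ (fun j _ => ler_sum _ (fun i _ => bound i j))) _.
under eq_bigr => j _ do rewrite !big_split /= -!mulr_sumr -!mulr_suml.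
rewrite !big_split /= -!mulr_sumr -!mulr_suml.
rewrite (relative_entropy_overlap) [X in _ <= _ + X / theta]exchange_big lerD2r.
(* Column sums of [g] control the part with [l], row sums the part with [mu]; then
   [theta / 6 + theta / 3 = theta / 2]. *)
have g1 : \sum_j \sum_i g j i * l i <= tA.
  rewrite exchange_big -sum_l; apply: ler_sum => i _; rewrite -mulr_suml.
  by rewrite -[leRHS]mul1r ler_wpM2r // contraction_col_sum.
have g2 : \sum_j (\sum_i g j i) * (c * mu j) <= tA.
  rewrite -ctB -sum_mu mulr_sumr; apply: ler_sum => j _.
  rewrite -[leRHS]mul1r; apply: ler_wpM2r; first exact: mulr_ge0.
  exact: contraction_row_sum.
have h6 : theta / 6 * \sum_j \sum_i g j i * l i <= theta / 6 * tA.
  by apply: ler_wpM2l => //; lra.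
have h3 : theta / 3 * \sum_j (\sum_i g j i) * (c * mu j) <= theta / 3 * tA.
  by apply: ler_wpM2l => //; lra.
lra.
Qed.

End OverlapExpansion.
End Pinsker.

(** * Local operators on the composite system and the partial trace *)

Section Embedding.
Variables (K : realType) (n : nat) (d : 'I_n -> nat).
Local Notation C := K[i].
Implicit Types (R : {set 'I_n}) (u v w : full_basis d).

Lemma restr_eqP R u v :
  restr R u = restr R v <-> (forall i, i \in R -> u i = v i).
Proof.
split=> [/ffunP h i iR|h]; first by have := h (Sub i iR); rewrite !ffunE.
by apply/ffunP => -[i iR]; rewrite !ffunE; apply: h.
Qed.

Definition glue R (s : sub_basis d R) u : full_basis d :=
  [ffun i => if @idP (i \in R) is ReflectT iR then s (Sub i iR) else u i].

Lemma restr_glue R (s : sub_basis d R) u : restr R (glue s u) = s.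
Proof.
apply/ffunP => -[i iR]; rewrite !ffunE; case: {-}_ / idP => //= iR'.
by rewrite (bool_irrelevance iR' iR).
Qed.

Lemma glueC R (s : sub_basis d R) u i : i \notin R -> glue s u i = u i.
Proof. by move=> iR; rewrite !ffunE; case: {-}_ / idP => // h; rewrite h in iR. Qed.

Lemma restrC_glue R (s : sub_basis d R) u : restr (~: R) (glue s u) = restr (~: R) u.
Proof. by apply/restr_eqP => i; rewrite finset.in_setC => /glueC. Qed.

Lemma matrix_basisP (A B : 'M[C]_(dim_full d)) :
  (forall u v, A (enum_rank u) (enum_rank v) = B (enum_rank u) (enum_rank v)) ->
  A = B.
Proof.
by move=> h; apply/matrixP => i j; rewrite -(enum_valK i) -(enum_valK j) h.
Qed.

Lemma sum_enum_rank (T : finType) (V : nmodType) (F : 'I_#|T| -> V) :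
  \sum_i F i = \sum_(w : T) F (enum_rank w).
Proof. exact/reindex/onW_bij/enum_rank_bij. Qed.

(* The operator [L (x) 1] on the whole system. *)
Definition emb R (L : 'M[C]_(dim_sub d R)) : 'M[C]_(dim_full d) :=
  \matrix_(i, j)
    (L (enum_rank (restr R (enum_val i))) (enum_rank (restr R (enum_val j)))
      *+ (restr (~: R) (enum_val i) == restr (~: R) (enum_val j))).

Lemma embE R (L : 'M[C]_(dim_sub d R)) u v :
  emb L (enum_rank u) (enum_rank v) =
  L (enum_rank (restr R u)) (enum_rank (restr R v))
    *+ (restr (~: R) u == restr (~: R) v).
Proof. by rewrite mxE !enum_rankK. Qed.

Lemma emb1 R : emb (1%:M : 'M[C]_(dim_sub d R)) = 1%:M.
Proof.
apply: matrix_basisP => u v; rewrite embE !mxE -mulrnA mulnb.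
congr (_ *+ nat_of_bool _); rewrite !(inj_eq enum_rank_inj).
by apply/andP/eqP => [[/eqP h1 /eqP h2]|->]; [apply: restr_inj h1 h2|].
Qed.

Lemma emb_sum R (I : finType) (L : I -> 'M[C]_(dim_sub d R)) :
  emb (\sum_y L y) = \sum_y emb (L y).
Proof.
apply: matrix_basisP => u v; rewrite embE !summxE -sumrMnl.
by apply: eq_bigr => y _; rewrite embE.
Qed.

Lemma emb_trmxC R (L : 'M[C]_(dim_sub d R)) : emb (L^t*) = (emb L)^t*.
Proof.
apply: matrix_basisP => u v; rewrite embE !mxE !enum_rankK rmorphMn.
by rewrite [in RHS]eq_sym.
Qed.

Lemma embM R (L M : 'M[C]_(dim_sub d R)) : emb (L *m M) = emb L *m emb M.
Proof.
apply: matrix_basisP => u v; rewrite embE !mxE !sum_enum_rank.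
under [RHS]eq_bigr => w _ do rewrite !embE.
rewrite [RHS](bigID (fun w => restr (~: R) w == restr (~: R) u)) /=.
rewrite [X in _ = _ + X]big1 ?addr0 => [|w /negbTE h]; last first.
  by rewrite eq_sym h mul0r.
rewrite (reindex_onto (fun s => glue s u) (restr R)) /= => [|w /eqP h]; last first.
  by apply: (@restr_inj _ _ R); rewrite ?restr_glue ?restrC_glue.
rewrite -sumrMnl; apply: eq_big => [s|s _].
  by rewrite restrC_glue restr_glue !eqxx.
by rewrite restrC_glue restr_glue eqxx mulr1n mulrnAr.
Qed.

(** Only one intermediate family contributes, the one equal to [v] on [R] and to [u] elsewhere. The
    resulting expression is symmetric in the two factors, whence [emb_comm]. *)
Lemma emb_mul_disjoint R R' (L : 'M[C]_(dim_sub d R)) (L' : 'M[C]_(dim_sub d R')) u v :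
  [disjoint R & R'] ->
  (emb L *m emb L') (enum_rank u) (enum_rank v) =
  L (enum_rank (restr R u)) (enum_rank (restr R v)) *
  L' (enum_rank (restr R' u)) (enum_rank (restr R' v))
    *+ [forall i, [|| i \in R, i \in R' | u i == v i]].
Proof.
move=> dis; have subR i : i \in R -> i \in ~: R'.
  by rewrite finset.in_setC => /(disjointFr dis) ->.
have subR' i : i \in R' -> i \in ~: R.
  by rewrite finset.in_setC => /(disjointFl dis) ->.
rewrite mxE sum_enum_rank; under eq_bigr => w _ do rewrite !embE.
rewrite (bigD1 (glue (restr R v) u)) //= [X in _ + X]big1 ?addr0; last first.
  move=> w ne; case: eqP => [e1|]; last by rewrite mul0r.
  case: eqP => [/restr_eqP e2|]; last by rewrite mulr0.
  case/negP: ne; apply/eqP/(@restr_inj _ _ R); last by rewrite restrC_glue.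
  by rewrite restr_glue; apply/restr_eqP => i /subR /e2.
rewrite restr_glue restrC_glue eqxx mulr1n mulrnAr.
have -> : restr R' (glue (restr R v) u) = restr R' u.
  by apply/restr_eqP => i /subR'; rewrite finset.in_setC => /glueC.
congr (_ *+ nat_of_bool _); apply/eqP/forallP => [/restr_eqP h i|h].
  have [//|iR] := boolP (i \in R); have [//|iR'] := boolP (i \in R').
  by rewrite -h ?finset.in_setC // glueC ?eqxx.
apply/restr_eqP => i; rewrite finset.in_setC => iR'.
have [iR|iR] := boolP (i \in R).
  have /restr_eqP -> // := restr_glue (restr R v) u.
by rewrite glueC //; have := h i; rewrite (negbTE iR) (negbTE iR') => /eqP.
Qed.

Lemma emb_comm R R' (L : 'M[C]_(dim_sub d R)) (L' : 'M[C]_(dim_sub d R')) :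
  [disjoint R & R'] -> emb L *m emb L' = emb L' *m emb L.
Proof.
move=> dis; apply: matrix_basisP => u v; rewrite !emb_mul_disjoint //; last first.
  by rewrite disjoint_sym.
rewrite mulrC; congr (_ *+ nat_of_bool _); apply: eq_forallb => i.
by rewrite orbCA.
Qed.

(** The duality of [emb] and [ptrace]; later facts about [ptrace] are read off from [emb] through
    it. *)
Lemma tr_emb R (L : 'M[C]_(dim_sub d R)) (x : 'M[C]_(dim_full d)) :
  \tr (emb L *m x) = \tr (L *m ptrace R x).
Proof.
rewrite /mxtrace !sum_enum_rank (partition_big (restr R) predT) //=.
apply: eq_bigr => s _; rewrite mxE sum_enum_rank.
transitivity (\sum_(u | restr R u == s) \sum_t \sum_(v | restr R v == t)
    emb L (enum_rank u) (enum_rank v) * x (enum_rank v) (enum_rank u)).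
  apply: eq_bigr => u _; rewrite mxE sum_enum_rank.
  by rewrite (partition_big (restr R) predT).
rewrite exchange_big; apply: eq_bigr => t _; rewrite mxE !enum_rankK mulr_sumr.
rewrite exchange_big; apply: eq_bigr => v /eqP vt; rewrite mulr_sumr.
rewrite [RHS]big_mkcondr; apply: eq_bigr => u /eqP us.
by rewrite embE us vt eq_sym; case: ifP; rewrite ?mul0r.
Qed.

End Embedding.

(** * The Heisenberg dual of a channel *)

Section Channel.
Variable K : realType.
Local Notation C := K[i].
Local Notation re := (@complex.Re K).

Lemma sum_mxtens (V : nmodType) k p (F : 'I_(k * p) -> V) :
  \sum_u F u = \sum_i \sum_a F (mxtens_index (i, a)).
Proof.
rewrite pair_bigA /=; apply: reindex; apply: onW_bij.
by exists (@mxtens_unindex k p) => [[i a]|u]; rewrite ?mxtens_indexK ?mxtens_unindexK.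
Qed.

(** The indices are swapped because [\tr (X *m delta_mx s t)] is [X t s]; [tr_adjoint] is the
    defining duality. *)
Definition adjoint k l (G : 'M[C]_k -> 'M[C]_l) (N : 'M[C]_l) : 'M[C]_k :=
  \matrix_(t, s) \tr (N *m G (delta_mx s t)).

Variables (k l : nat) (G : {linear 'M[C]_k -> 'M[C]_l}).

Lemma tr_adjoint N x : \tr (adjoint G N *m x) = \tr (N *m G x).
Proof.
transitivity (\sum_s \sum_t x s t * \tr (N *m G (delta_mx s t))).
  rewrite exchange_big; apply: eq_bigr => t _; rewrite mxE.
  by apply: eq_bigr => s _; rewrite mxE mulrC.
rewrite [x in RHS]matrix_sum_delta linear_sum mulmx_sumr.
rewrite (raddf_sum (@mxtrace C l)); apply: eq_bigr => s _.
rewrite linear_sum mulmx_sumr (raddf_sum (@mxtrace C l)); apply: eq_bigr => t _.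
by rewrite linearZ /= -scalemxAr mxtraceZ.
Qed.

Lemma adjoint_sum (I : finType) (N : I -> 'M[C]_l) :
  adjoint G (\sum_z N z) = \sum_z adjoint G (N z).
Proof.
apply/matrixP => t s; rewrite mxE summxE mulmx_suml raddf_sum.
by apply: eq_bigr => z _; rewrite mxE.
Qed.

(** Extracts plain positivity from complete positivity with a one-dimensional ancilla, across the
    distinct types of size [m] and [m * 1]. *)
Lemma psd_tens1 m (x : 'M[C]_m) : psd x <-> psd (x *t (1%:M : 'M[C]_1)).
Proof.
have e (v : 'cV[C]_(m * 1)) :
    quad (x *t 1%:M) v = quad x (\col_i v (mxtens_index (i, 0)) 0).
  rewrite !quadE sum_mxtens; apply: eq_bigr => i _; rewrite big_ord1 sum_mxtens.
  by apply: eq_bigr => j _; rewrite big_ord1 tensmxE !mxE eqxx mulr1.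
split=> [h v|h v]; first by rewrite e.
have := h (\col_u v (mxtens_unindex u).1 0); rewrite e.
by congr (0 <= quad x _); apply/colP => i; rewrite !mxE mxtens_indexK.
Qed.

Hypothesis hG : quantum_channel G.

Lemma channel_positive x : psd x -> psd (G x).
Proof.
move=> /psd_tens1/psdmxP/hG.1/psdmxP; rewrite tens_id_tens => h.
by apply/psd_tens1.
Qed.

Lemma channel_trmxC x : G (x^t*) = (G x)^t*.
Proof.
have herm y : y^t* = y -> (G y)^t* = G y.
  move=> /herm_psd_diff[P [N [hP hN ->]]]; rewrite linearB trmxC_add trmxC_opp.
  by rewrite !psd_herm //; apply: channel_positive.
have [X [Y [hX hY ->]]] := herm_decomp x.
have GE a : G (X + a *: Y) = G X + a *: G Y by rewrite linearD linearZ.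
rewrite (herm_combination 'i hX hY).
rewrite [in RHS]GE.
rewrite (herm_combination 'i (herm X hX) (herm Y hY)).
by rewrite GE.
Qed.

Lemma psd_adjoint N : psd N -> psd (adjoint G N).
Proof.
move=> hN v; have := psd_mxtrace_mul_ge0 hN (channel_positive (psd_gramC v)).
by rewrite -tr_adjoint -quad_tr.
Qed.

Lemma adjoint1 : adjoint G 1%:M = 1%:M.
Proof.
apply/matrixP => t s; rewrite !mxE mul1mx hG.2.
rewrite /mxtrace (bigD1 s) //= big1 ?addr0; first by rewrite mxE eqxx eq_sym.
by move=> i /negbTE h; rewrite mxE h.
Qed.

End Channel.

(** * Conditioning until no block reveals much more *)

Section Conditioning.
Variables (K : realType) (dA n : nat) (d : 'I_n -> nat).
Local Notation C := K[i].
Variable Lambda : {linear 'M[C]_dA -> 'M[C]_(dim_full d)}.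
Hypothesis hLambda : quantum_channel Lambda.
Local Notation adj := (adjoint Lambda).

(** Acting only on [Q] is expressed by commutation with operators elsewhere. This is stable under
    enlarging [Q] and under products, without identifying the space of [Q :|: R] with a tensor
    product. *)
Definition localized (Q : {set 'I_n}) (N : 'M[C]_(dim_full d)) : Prop :=
  forall (R : {set 'I_n}) (L : 'M[C]_(dim_sub d R)),
    [disjoint R & Q] -> N *m emb L = emb L *m N.

Lemma psd_localized_mul Q R (N : 'M[C]_(dim_full d)) (L : 'M[C]_(dim_sub d R)) :
  psd N -> localized Q N -> [disjoint R & Q] -> psd L -> psd (N *m emb L).
Proof.
move=> hN locN dis /psd_factor[D ->].
apply: (@psd_mul_comm _ _ _ _ (emb D)) => //; first by rewrite embM emb_trmxC.
by rewrite -emb_trmxC locN.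
Qed.

Lemma localized_mul Q R (N : 'M[C]_(dim_full d)) (L : 'M[C]_(dim_sub d R)) :
  localized Q N -> localized (Q :|: R) (N *m emb L).
Proof.
move=> locN R' L' dis.
have dQ : [disjoint R' & Q] := disjointWr (finset.subsetUl Q R) dis.
have dR : [disjoint R & R'].
  by rewrite disjoint_sym (disjointWr (finset.subsetUr Q R)).
by rewrite -mulmxA (emb_comm _ _ dR) !mulmxA locN.
Qed.

Lemma extend_card (Q0 : {set 'I_n}) q : (#|Q0| <= q <= n)%N ->
  exists2 Q : {set 'I_n}, Q0 \subset Q & #|Q| = q.
Proof.
elim: q => [|q IH] /andP[le1 le2].
  by exists Q0 => //; apply/eqP; rewrite -leqn0.
move: le1; rewrite leq_eqVlt => /predU1P[e|lt1]; first by exists Q0.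
have [|Q sQ cQ] := IH; first by rewrite -ltnS lt1 ltnW.
have /card_gt0P[x] : (0 < #|~: Q|)%N.
  by have := cardsC Q; rewrite cQ card_ord; lia.
rewrite finset.in_setC => xQ; exists (x |: Q).
  exact/(fintype.subset_trans sQ)/finset.subsetU1.
by rewrite cardsU1 xQ cQ.
Qed.

(* Measuring systems one block of [r] at a time, each measurement that reveals
   more than [eps] lowers the total conditional entropy, which lies between
   [0] and [dA * ln dA]; hence this happens fewer than [q / r] times. *)
Lemma exists_saturating_measurement q r :
  (2 <= dA)%N -> (1 <= q <= n)%N -> (1 <= r <= n)%N ->
  exists (I : finType) (N : I -> 'M[C]_(dim_full d)) (Q : {set 'I_n}),
    [/\ forall z, psd (N z), \sum_z N z = 1%:M, forall z, localized Q (N z),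
        #|Q| = q &
        forall R : {set 'I_n}, #|R| = r -> [disjoint R & Q] ->
        forall (J : finType) (L : J -> 'M[C]_(dim_sub d R)),
          (forall y, psd (L y)) -> \sum_y L y = 1%:M ->
          \sum_z (entropy (adj (N z)) - \sum_y entropy (adj (N z *m emb (L y))))
            <= dA%:R * (ln dA%:R * (r%:R / q%:R))].
Proof.
move=> hdA /andP[q1 qn] /andP[r1 rn]; apply: contrapT => none.
pose eps : K := ln dA%:R * (r%:R / q%:R).
have dA0 : 0 < dA%:R :> K by rewrite ltr0n; lia.
have ln0 : 0 < ln dA%:R :> K by rewrite ln_gt0 // ltr1n.
have q0 : 0 < q%:R :> K by rewrite ltr0n.
(* [P k] records [k] successful rounds, each gaining at least [dA * eps]. Nonnegative entropy then
   forces [k * eps <= ln dA], that is [k * r <= q]. *)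
pose P k := exists (I : finType) (N : I -> 'M[C]_(dim_full d)) (Q : {set 'I_n}),
    [/\ forall z, psd (N z), \sum_z N z = 1%:M, forall z, localized Q (N z),
        #|Q| = (k * r)%N &
        \sum_z entropy (adj (N z)) <= dA%:R * (ln dA%:R - k%:R * eps)].
have Pbound k : P k -> (k * r <= q)%N.
  move=> [I [N [Q [psdN _ _ _ le]]]].
  have : 0 <= dA%:R * (ln dA%:R - k%:R * eps).
    apply: le_trans le; apply: sumr_ge0 => z _.
    exact/entropy_ge0/psd_adjoint.
  rewrite pmulr_rge0 // subr_ge0 /eps mulrCA ger_pMr // mulrA.
  by rewrite ler_pdivrMr // mul1r -natrM ler_nat.
(* [P q.+1] would place [q + 1] blocks of [r >= 1] systems within [q] systems. *)
suff Pall k : P k by have := Pbound _ (Pall q.+1); nia.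
elim: k => [|k IH].
  exists unit, (fun=> 1%:M), finset.set0; split.
  - by move=> _; apply: psd1.
  - by rewrite big_const /= card_unit /= addr0.
  - by move=> _ R L _; rewrite mul1mx mulmx1.
  - by rewrite finset.cards0.
  - rewrite big_const card_unit /= addr0 adjoint1 // entropy1.
    by rewrite mul0r subr0.
have krq := Pbound _ IH.
case: IH => I [N [Q0 [psdN sumN locN cardQ0 entN]]].
(* Padding to size exactly [q] keeps the operators localized, and a block disjoint from [Q] is
   disjoint from [Q0], so a failure of saturation at [Q] supplies the next round. *)
have [|Q sQ cQ] := @extend_card Q0 q; first by rewrite cardQ0 krq.
apply: contrapT => notP; apply: none; exists I, N, Q; split=> //.
  by move=> z R L dis; apply: locN; rewrite (disjointWr sQ).
move=> R cR dis J L psdL sumL; rewrite leNgt; apply/negP => gain; apply: notP.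
have dis0 : [disjoint R & Q0] by rewrite (disjointWr sQ).
exists (I * J)%type, (fun zy => N zy.1 *m emb (L zy.2)), (Q0 :|: R); split.
- by move=> [z y]; apply: psd_localized_mul (psdN z) (locN z) dis0 (psdL y).
- rewrite -(pair_bigA _ (fun z y => N z *m emb (L y))) /=.
  under eq_bigr => z _ do rewrite -mulmx_sumr -emb_sum sumL emb1 mulmx1.
  exact: sumN.
- by move=> [z y]; apply: localized_mul.
- rewrite cardsU disjoint_setI0 1?disjoint_sym // finset.cards0 subn0 cardQ0 cR.
  by rewrite mulSn addnC.
- rewrite -(pair_bigA _ (fun z y => entropy (adj (N z *m emb (L y))))) /=.
  move: gain; rewrite sumrB -/eps => gain.
  by rewrite -natr1 mulrDl mul1r opprD addrA mulrBr; lra.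
Qed.

End Conditioning.

(** * The bound against local tests *)

Section LocalBound.
Variable K : realType.
Local Notation C := K[i].
Local Notation re := (@complex.Re K).
Local Notation "x %:C" := (real_complex K x) : ring_scope.

(** A bound on the Choi operator of [D] under one-way local tests: the output is measured and the
    outcome selects a contraction on the input side. *)
Definition local_bound k l (D : 'M[C]_k -> 'M[C]_l) (b : K) : Prop :=
  forall (J : finType) (L : J -> 'M[C]_l) (f : J -> 'M[C]_k),
    (forall y, psd (L y)) -> \sum_y L y = 1%:M -> (forall y, contraction (f y)) ->
    re (\sum_y \tr (L y *m D (f y))) <= b.

Lemma psd_mxtrace_eq0 n (A : 'M[C]_n) : psd A -> re (\tr A) = 0 -> A = 0.
Proof.
move=> hA tr0; rewrite (herm_spectral (psd_herm hA)).
suff -> : diag_mx (spectral_diag A) = 0 by rewrite mulmx0 mul0mx.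
apply/matrixP => i j; rewrite !mxE eigvalE ?psd_herm //.
suff -> : eigval A i = 0 by rewrite mul0rn.
have ge0 m : 0 <= eigval A m by apply: eigval_ge0.
apply/eqP; rewrite eq_le ge0 andbT -tr0 -sum_eigval ?psd_herm //.
by rewrite (bigD1 i) //= lerDl; apply: sumr_ge0.
Qed.

Variables (dA n : nat) (d : 'I_n -> nat).
Variable Lambda : {linear 'M[C]_dA -> 'M[C]_(dim_full d)}.
Hypothesis hLambda : quantum_channel Lambda.
Local Notation adj := (adjoint Lambda).

(** A factor [d i = 0] would make the output space zero, and then [Lambda 1%:M] could not have trace
    [dA]. *)
Lemma dim_sub_gt0 (R : {set 'I_n}) : (0 < dA)%N -> (0 < dim_sub d R)%N.
Proof.
move=> dA0; suff /card_gt0P[u _] : (0 < dim_full d)%N.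
  by apply/card_gt0P; exists (restr R u).
case: (posnP (dim_full d)) => // e.
have := hLambda.2 1%:M; rewrite mxtrace1 {1}/mxtrace big1; last first.
  by move=> i _; have := ltn_ord i; rewrite {2}e ltn0.
by move/esym/eqP; rewrite pnatr_eq0 => /eqP h; rewrite h in dA0.
Qed.

Section PreparedStates.
Variables (I : finType) (N : I -> 'M[C]_(dim_full d)) (Q R : {set 'I_n}).
Hypotheses (dA0 : (0 < dA)%N) (psdN : forall z, psd (N z)) (sumN : \sum_z N z = 1%:M).
Hypotheses (locN : forall z, localized Q (N z)) (dis : [disjoint R & Q]).

Let M z := adj (N z).
Let t z : K := re (\tr (M z)).

Let psdM z : psd (M z). Proof. exact: psd_adjoint. Qed.

Let trM z : \tr (M z) = (t z)%:C.
Proof. exact/ge0_reE/psd_mxtrace_ge0. Qed.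

(** The state of [R] given outcome [z] on maximally mixed input. An outcome of zero trace has effect
    zero, so any state will do there; the maximally mixed one is taken. *)
Definition prepared z : 'M[C]_(dim_sub d R) :=
  if re (\tr (adj (N z))) == 0 then (dim_sub d R)%:R^-1 *: 1%:M
  else ((re (\tr (adj (N z))))^-1)%:C *: ptrace R (N z *m Lambda 1%:M).

Lemma prepared_state z : is_state (prepared z).
Proof.
rewrite /prepared -/(M z) -/(t z); case: eqVneq => [_|t0]; split.
- by apply/psdmxP/psdZ; [rewrite invr_ge0 ler0n | apply: psd1].
- by rewrite mxtraceZ mxtrace1 mulVf // pnatr_eq0 -lt0n dim_sub_gt0.
- apply/psdmxP/psdZ.
    by rewrite ler0c invr_ge0; apply/ge0_re/psd_mxtrace_ge0.
  move=> v; rewrite quad_tr mxtrace_mulC -tr_emb mulmxA -(locN z) //.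
  apply: psd_mxtrace_mul_ge0; last exact/(channel_positive hLambda)/psd1.
  exact: psd_localized_mul (psdN z) (locN z) dis (psd_gramC v).
- rewrite mxtraceZ mxtrace_ptrace -tr_adjoint mulmx1 -/(M z) trM.
  by rewrite -(rmorphM (real_complex K)) mulVf.
Qed.

Definition defect (x : 'M[C]_dA) : 'M[C]_(dim_sub d R) :=
  ptrace R (Lambda x) - measure_prepare (fun z => adj (N z)) prepared x.

(** Inserting [\sum_z N z = 1%:M] splits the channel over [z], and [prepared] assigns [L] the
    probability that appears as the ratio of traces. Each summand is then of the form treated by
    [pinsker]. *)
Lemma tr_defect L x : psd L ->
  \tr (L *m defect x) = \sum_z \tr (x *m (adj (N z *m emb L) -
    (re (\tr (adj (N z *m emb L))) / re (\tr (adj (N z))))%:C *: adj (N z))).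
Proof.
move=> psdL; rewrite /defect mulmxBr raddfB /= -tr_emb.
have -> : \tr (emb L *m Lambda x) = \sum_z \tr (x *m adj (N z *m emb L)).
  have -> : \tr (emb L *m Lambda x) = \tr (\sum_z adj (N z *m emb L) *m x).
    by rewrite -mulmx_suml -adjoint_sum -mulmx_suml sumN mul1mx tr_adjoint.
  rewrite (raddf_sum (@mxtrace C dA)); apply: eq_bigr => z _.
  exact: mxtrace_mulC.
rewrite /measure_prepare mulmx_sumr (raddf_sum (@mxtrace C _)) -sumrB.
apply: eq_bigr => z _; rewrite mulmxBr [in RHS]raddfB /=; congr (_ - _).
rewrite -!scalemxAr !mxtraceZ  [\tr (x *m _)]mxtrace_mulC mulrC.
rewrite /prepared; case: eqVneq => [t0|t0].
  have -> : adj (N z) = 0 by apply: psd_mxtrace_eq0 t0; apply: psdM.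
  by rewrite mul0mx mxtrace0 !(mulr0, mul0r).
congr (_ * _). rewrite -scalemxAr mxtraceZ -tr_emb mulmxA -(locN z) //.
rewrite -tr_adjoint mulmx1 rmorphM mulrC; congr (_ * _).
apply/ge0_reE/psd_mxtrace_ge0/psd_adjoint => //.
exact: psd_localized_mul (psdN z) (locN z) dis psdL.
Qed.

Lemma defect_local_bound (eps : K) :
  0 < eps ->
  (forall (J : finType) (L : J -> 'M[C]_(dim_sub d R)),
     (forall y, psd (L y)) -> \sum_y L y = 1%:M ->
     \sum_z (entropy (adj (N z)) - \sum_y entropy (adj (N z *m emb (L y))))
       <= dA%:R * eps) ->
  local_bound defect (dA%:R * Num.sqrt (2 * eps)).
Proof.
(* This [theta] minimises [dA * theta / 2 + dA * eps / theta], the total of the Pinsker bounds, by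
   making both terms equal. *)
move=> eps0 sat J L f psdL sumL hf; set theta := Num.sqrt (2 * eps).
have th2 : theta ^+ 2 = 2 * eps by rewrite sqr_sqrtr // mulr_ge0 // ltW.
have th0 : 0 < theta by rewrite sqrtr_gt0 mulr_gt0.
pose A z y := adj (N z *m emb (L y)).
have psdA z y : psd (A z y).
  by apply: psd_adjoint => //; apply: psd_localized_mul (psdN z) (locN z) dis (psdL y).
have sumA z : \sum_y A z y = M z.
  by rewrite -adjoint_sum -mulmx_sumr -emb_sum sumL emb1 mulmx1.
have leA z y : psd (M z - A z y).
  rewrite -sumA (bigD1 y) //= addrAC subrr add0r; exact: psd_sum.
rewrite re_sum; under eq_bigr => y _ do rewrite tr_defect // re_sum.
apply: (@le_trans _ _ (\sum_y \sum_z
    (theta / 2 * re (\tr (A z y)) + relative_entropy (A z y) (M z) / theta))).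
  apply: ler_sum => y _; apply: ler_sum => z _.
  exact: (pinsker (psdA z y) (psdM z) (leA z y) (hf y) th0).
rewrite exchange_big; under eq_bigr => z _ do
  rewrite big_split /= -mulr_sumr -mulr_suml -re_sum -(raddf_sum (@mxtrace C dA))
    sumA (sum_relative_entropy (psd_herm (psdM z)) (sumA z)).
rewrite big_split /= -mulr_sumr -mulr_suml -re_sum -(raddf_sum (@mxtrace C dA)) /=.
rewrite -adjoint_sum sumN adjoint1 // mxtrace1 -(rmorph_nat (real_complex K)) /=.
have := sat J L psdL sumL; rewrite -/M.
set S := \sum_z _ => leS.
have : S / theta <= dA%:R * eps / theta by rewrite ler_pM2r ?invr_gt0.
have -> : dA%:R * eps / theta = dA%:R * theta / 2.
  have -> : eps = theta ^+ 2 / 2 by rewrite th2; field.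
  by field; rewrite gt_eqF.
lra.
Qed.

End PreparedStates.
End LocalBound.

(** * Block pairings: the bound with factor [2 dA] *)

Section LocalToGlobal.
Variable K : realType.
Local Notation C := K[i].
Local Notation re := (@complex.Re K).
Local Notation "x %:C" := (real_complex K x) : ring_scope.

Lemma contraction0 n : contraction (0 : 'M[C]_n).
Proof. by split; rewrite ?mulmx0 ?mul0mx subr0; apply: psd1. Qed.

(* [1 - f^2] is the average of [(1+f)(1-f)(1+f)] and [(1-f)(1+f)(1-f)]. *)
Lemma herm_contraction n (f : 'M[C]_n) :
  psd (1%:M - f) -> psd (1%:M + f) -> contraction f.
Proof.
move=> h1 h2; have hf : f^t* = f.
  have := psd_herm h2; rewrite trmxC_add trmxC1; exact: addrI.
suff h : psd (1%:M - f *m f) by split; rewrite hf.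
have -> : 1%:M - f *m f = 2^-1 *: ((1%:M + f)^t* *m (1%:M - f) *m (1%:M + f) +
    (1%:M - f)^t* *m (1%:M + f) *m (1%:M - f)).
  rewrite (psd_herm h1) (psd_herm h2).
  rewrite !(mulmxDl, mulmxDr, mul1mx, mulmx1, mulNmx, mulmxN, opprD, opprK).
  move: (f *m f *m f) (f *m f) => F3 F2; apply/matrixP => i j; rewrite !mxE.
  by move: (F3 i j) (F2 i j) (f i j) (i == j)%:R => x y z w; field.
apply: psdZ; first by rewrite invr_ge0 ler0n.
by apply: psdD; apply: psd_conj.
Qed.

Variables (k l : nat) (D : {linear 'M[C]_k -> 'M[C]_l}) (b : K).
Hypothesis hD : local_bound D b.

(** After division by [c], the missing part of the identity becomes one more outcome, paired with
    the zero contraction. *)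
Lemma local_bound_subpovm (J : finType) (L : J -> 'M[C]_l) (f : J -> 'M[C]_k) (c : K) :
  0 < c -> (forall y, psd (L y)) -> psd (c%:C *: 1%:M - \sum_y L y) ->
  (forall y, contraction (f y)) ->
  re (\sum_y \tr (L y *m D (f y))) <= c * b.
Proof.
move=> c0 psdL subL hf; rewrite -ler_pdivrMl //.
have ci0 : 0 <= (c^-1)%:C :> C by rewrite ler0c invr_ge0 ltW.
pose L' o := if o is Some y then (c^-1)%:C *: L y
             else 1%:M - \sum_y (c^-1)%:C *: L y.
pose f' o := if o is Some y then f y else 0.
have : re (\sum_o \tr (L' o *m D (f' o))) <= b.
  apply: hD => [[y|]||[y|]] /=.
  - exact: psdZ ci0 (psdL y).
  - have -> : 1%:M - \sum_y (c^-1)%:C *: L y =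
        (c^-1)%:C *: (c%:C *: 1%:M - \sum_y L y).
      rewrite scalerBr scalerA -(rmorphM (real_complex K)) mulVf ?gt_eqF //.
      by rewrite scale1r scaler_sumr.
    exact: psdZ ci0 subL.
  - by rewrite big_option /= subrK.
  - exact: hf.
  - exact: contraction0.
rewrite big_option /f' /L' (raddf0 D) mulmx0 mxtrace0 add0r.
rewrite -reMl mulr_sumr; congr (re _ <= _).
by apply: eq_bigr => y _; rewrite -scalemxAl mxtraceZ.
Qed.

(** The trace of the block operator with blocks [Z t s] against the Choi matrix of [D]. *)
Definition pairing (Z : 'I_k -> 'I_k -> 'M[C]_l) : C :=
  \sum_s \sum_t \tr (Z t s *m D (delta_mx s t)).

(** Orthogonality of the characters of the cyclic group of order four. *)
Lemma sum_powers_i (m : nat) :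
  \sum_(e < 4) 'i ^+ (e * m) = (4 *+ (4 %| m)%N : C).
Proof.
have i4 : 'i ^+ 4 = 1 :> C by rewrite (exprM _ 2 2) sqrCi sqrrN expr1n.
have e4 e : 'i ^+ (e * m) = 'i ^+ (e * (m %% 4)) :> C.
  have {1}-> : (e * m = 4 * (e * (m %/ 4)) + e * (m %% 4))%N.
    by rewrite {1}(divn_eq m 4); ring.
  by rewrite exprD exprM i4 expr1n mul1r.
under eq_bigr => e _ do rewrite e4.
rewrite /dvdn; have := ltn_pmod m (isT : (0 < 4)%N).
move: (m %% 4)%N => r; rewrite !big_ord_recl big_ord0 /=.
have i2 : 'i ^+ 2 = -1 :> C := sqrCi _.
have i3 : 'i ^+ 3 = - 'i :> C by rewrite exprS i2 mulrN1.
have i6 : 'i ^+ 6 = -1 :> C by rewrite (exprM _ 2 3) i2; ring.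
have i9 : 'i ^+ 9 = 'i :> C by rewrite (exprD _ 4 5) (exprD _ 4 1) i4 !mul1r expr1.
case: r => [|[|[|[|//]]]] _; rewrite ?muln0 ?muln1 /= ?expr0 ?expr1 ?i2 ?i3 ?i4 ?i6 ?i9;
 rewrite ?mulr1n ?mulr0n; by ring.
Qed.


Lemma sum_pairE (V : nmodType) (A B : finType) (F : A * B -> V) :
  \sum_p F p = \sum_a \sum_c F (a, c).
Proof. by rewrite pair_bigA; apply: eq_bigr => -[]. Qed.

Lemma contraction_delta (a : C) (s t : 'I_k) : a * a^* = 1 ->
  contraction (a *: delta_mx s t).
Proof.
move=> a1; have h (i : 'I_k) : psd (1%:M - delta_mx i i : 'M[C]_k).
  have -> : 1%:M - delta_mx i i = (1%:M - delta_mx i i : 'M[C]_k)^t* *m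
      (1%:M - delta_mx i i).
    rewrite trmxC_add trmxC_opp trmxC1 trmx_delta map_delta_mx.
    by rewrite mulmxBl mul1mx mulmxBr mulmx1 mul_delta_mx subrr subr0.
  exact: psd_gram.
split; rewrite trmxC_scale trmx_delta map_delta_mx -scalemxAl -scalemxAr scalerA;
  by rewrite mul_delta_mx ?[_^* * _]mulrC a1 scale1r.
Qed.

Definition wi (m : 'I_4) : C := 'i ^+ m.

Lemma conj_powi e : ('i ^+ e)^* = 'i ^+ (e * 3) :> C.
Proof.
rewrite rmorphXn /= conjCi [in RHS]mulnC exprM.
by congr (_ ^+ _); rewrite exprS sqrCi mulrN1.
Qed.

Lemma powi_conj e : 'i ^+ e * ('i ^+ e)^* = 1 :> C.
Proof. by rewrite -normCK normrX normCi !expr1n. Qed.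

Lemma sum_wi : \sum_m wi m = 0.
Proof.
transitivity (\sum_(e < 4) 'i ^+ (e * 1) : C); last by rewrite sum_powers_i.
by apply: eq_bigr => m _; rewrite muln1.
Qed.

Lemma sum_wi2 : \sum_m wi m * wi m = 0.
Proof.
transitivity (\sum_(e < 4) 'i ^+ (e * 2) : C); last by rewrite sum_powers_i.
by apply: eq_bigr => m _; rewrite /wi -exprD muln2 addnn.
Qed.

(* Each [Z t s] is a combination, with the phases [i^m], of four positive
   operators, and the phase is absorbed in the attached matrix unit. *)
Lemma pairing_bound_left Z : (0 < k)%N ->
  psd (1%:M - \sum_s \sum_t Z t s *m (Z t s)^t*) ->
  re (pairing Z) <= 2 * k%:R * b.
Proof.
move=> k0 hZ; have kC : k%:R != 0 :> C by rewrite pnatr_eq0 -lt0n.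
have kconj : (k%:R : C)^* = k%:R by rewrite rmorph_nat.
(* In [X *m X^t*] the four phases isolate the term linear in [Z t s]. The weight [k] balances the
   total of the [L y], which is [k] times the identity plus [k] times the sum of all [Z *m Z^t*],
   hence at most [2 * k]. *)
pose X (y : 'I_k * 'I_k * 'I_4) : 'M[C]_l :=
  1%:M + ((wi y.2)^* * k%:R) *: Z y.1.2 y.1.1.
pose L y := (4 * k%:R)^-1 *: (X y *m (X y)^t*).
pose f (y : 'I_k * 'I_k * 'I_4) : 'M[C]_k := wi y.2 *: delta_mx y.1.1 y.1.2.
have XX s t m : X (s, t, m) *m (X (s, t, m))^t* = 1%:M +
    ((wi m)^* * k%:R) *: Z t s + (wi m * k%:R) *: (Z t s)^t* +
    (k%:R ^+ 2) *: (Z t s *m (Z t s)^t*).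
  rewrite /X /= trmxC_add trmxC_scale trmxC1 rmorphM /= conjCK kconj.
  rewrite mulmxDl !mulmxDr !mul1mx mulmx1 -!scalemxAl -!scalemxAr scalerA !addrA.
  congr (_ + _ *: _); first by rewrite addrAC.
  rewrite mulrACA [_^* * _]mulrC powi_conj mul1r -expr2 //.
have sZ (F : 'I_4 -> C) (A : 'M[C]_l) : \sum_m F m *: A = (\sum_m F m) *: A.
  by rewrite scaler_suml.
have sum1 s t : \sum_m wi m *: (X (s, t, m) *m (X (s, t, m))^t*) =
    (4 * k%:R) *: Z t s.
  under eq_bigr => m _ do rewrite XX !scalerDr !scalerA !mulrA powi_conj mul1r.
  rewrite !big_split /= !sZ -!mulr_suml sum_wi sum_wi2 !mul0r !scale0r add0r !addr0.
  by rewrite sumr_const card_ord -[k%:R *+ 4]mulr_natl.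
have sum2 s t : \sum_m X (s, t, m) *m (X (s, t, m))^t* =
    4 *: (1%:M + (k%:R ^+ 2) *: (Z t s *m (Z t s)^t*)).
  under eq_bigr => m _ do rewrite XX.
  have sumc : \sum_m (wi m)^* = 0 by rewrite -rmorph_sum sum_wi rmorph0.
  rewrite !big_split /= !sZ -!mulr_suml sum_wi sumc !mul0r !scale0r !addr0.
  rewrite !sumr_const !card_ord -[k%:R *+ 4]mulr_natl -mulrA.
  rewrite -expr2 -[1%:M *+ 4]scaler_nat.
  by rewrite scalerDr scalerA.
have -> : pairing Z = \sum_y \tr (L y *m D (f y)).
  rewrite sum_pairE sum_pairE; apply: eq_bigr => s _; apply: eq_bigr => t _.
  transitivity (\sum_m \tr ((4 * k%:R)^-1 *: (wi m *: (X (s, t, m) *m (X (s, t, m))^t*))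
      *m D (delta_mx s t))); last first.
    apply: eq_bigr => m _; rewrite /L /f /=.
    have -> : D (wi m *: delta_mx s t) = wi m *: D (delta_mx s t) by rewrite linearZ.
    by rewrite -!scalemxAl -scalemxAr !mxtraceZ.
  rewrite -raddf_sum -mulmx_suml -scaler_sumr sum1 scalerA mulVf ?scale1r //.
  by rewrite mulf_neq0 // pnatr_eq0.
apply: local_bound_subpovm.
- by rewrite mulr_gt0 // ltr0n.
- by move=> y; apply: psdZ (psd_gramC _); rewrite invr_ge0 mulr_ge0.
- rewrite sum_pairE sum_pairE.
  under eq_bigr => s _ do under eq_bigr => t _ do
    rewrite /L -scaler_sumr sum2 scalerA.
  have c4 : (4 * k%:R)^-1 * 4 = k%:R^-1 :> C by field.
  under eq_bigr => s _ do rewrite c4 -scaler_sumr big_split /= -scaler_sumr.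
  rewrite -scaler_sumr big_split /= -scaler_sumr !sumr_const !card_ord.
  set S := \sum_s _ in hZ *.
  have -> : (2 * k%:R)%:C *: 1%:M - k%:R^-1 *: (1%:M *+ k *+ k + k%:R ^+ 2 *: S) =
      k%:R *: (1%:M - S).
    have -> : (2 * k%:R)%:C = 2 * k%:R :> C.
      by rewrite (rmorphM (real_complex K)) !(rmorph_nat (real_complex K)).
    have -> : 1%:M *+ k *+ k = (k%:R * k%:R) *: 1%:M :> 'M[C]_l.
      by rewrite -scalerA !scaler_nat.
    apply/matrixP => i j; rewrite !(scalemxE, addmxE, oppmxE).
    by move: (S i j) ((1%:M : 'M[C]_l) i j) => x y; field.
  by apply: psdZ hZ; rewrite ler0n.
- by move=> [[s t] m]; apply/contraction_delta/powi_conj.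
Qed.

End LocalToGlobal.

(** * Standard basis and phase vectors: the bound with factor [2 d_R - 1] *)

Section RightBound.
Variable K : realType.
Local Notation C := K[i].
Local Notation re := (@complex.Re K).
Local Notation "x %:C" := (real_complex K x) : ring_scope.

Section Phases.
Variable l : nat.

(** The coordinates of [phi] are independent, so the sum factors into character sums. *)
Lemma phase_sum (m : 'I_l -> nat) :
  \sum_(phi : {ffun 'I_l -> 'I_4}) 'i ^+ (\sum_x phi x * m x) =
  (4 ^+ l *+ [forall x, 4 %| m x]%N : C).
Proof.
under eq_bigr => phi _ do rewrite -prodrXr.
rewrite -(bigA_distr_bigA (fun x (e : 'I_4) => 'i ^+ (e * m x) : C)).
under eq_bigr => x _ do rewrite sum_powers_i.
case: forallP => [h|/forallP].
  rewrite (eq_bigr (fun=> 4)) ?prodr_const ?card_ord // => x _.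
  by rewrite h.
by rewrite negb_forall => /existsP[x /negbTE h]; rewrite (bigD1 x) //= h mul0r.
Qed.

Definition phase (phi : {ffun 'I_l -> 'I_4}) : 'cV[C]_l := \col_x 'i ^+ phi x.

Lemma sum_indicator (phi : {ffun 'I_l -> 'I_4}) (c : nat) i :
  (\sum_x phi x * (c * (x == i)) = c * phi i)%N.
Proof.
rewrite (bigD1 i) //= big1 ?addn0 ?eqxx ?muln1 1?mulnC // => x /negbTE ->.
by rewrite !muln0.
Qed.

Lemma phase_second_moment i j :
  \sum_phi phase phi i 0 * (phase phi j 0)^* = 4 ^+ l *+ (i == j).
Proof.
under eq_bigr => phi _.
  rewrite !mxE conj_powi -exprD.
  rewrite (_ : phi i + phi j * 3 = \sum_x phi x * (1 * (x == i) + 3 * (x == j)))%N.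
    over.
  by under eq_bigr do rewrite mulnDr; rewrite big_split /= !sum_indicator mul1n mulnC.
rewrite phase_sum; congr (_ *+ nat_of_bool _).
apply/forallP/eqP => [/(_ i)|-> x]; last by case: (x == j).
by rewrite eqxx; case: eqP.
Qed.

(** Divisibility by four is tested at [j] and at [k]. Fourth roots of unity are used because signs
    would also let the transposed match [k = i'], [j = i] survive. *)
Lemma phase_fourth_moment i i' j k : j != k ->
  \sum_phi ((phase phi i 0)^* * phase phi i' 0) * ((phase phi j 0)^* * phase phi k 0)
    = 4 ^+ l *+ ((k == i) && (j == i')).
Proof.
move=> jk; under eq_bigr => phi _.
  rewrite !mxE !conj_powi -!exprD.
  rewrite (_ : phi i * 3 + phi i' + (phi j * 3 + phi k) =
    \sum_x phi x * ((3 * (x == i) + 1 * (x == i')) + (3 * (x == j) + 1 * (x == k))))%N.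
    over.
  under eq_bigr => x _ do
    rewrite mulnDr (mulnDr _ (3 * (x == i))%N) (mulnDr _ (3 * (x == j))%N).
  by rewrite !big_split /= !sum_indicator !mul1n ![(3 * _)%N]mulnC.
rewrite phase_sum; congr (_ *+ nat_of_bool _).
apply/forallP/andP => [h|[/eqP -> /eqP ->] x]; last first.
  by case: (x == i); case: (x == i').
have := h k; have := h j; rewrite !eqxx (negbTE jk) [k == j]eq_sym (negbTE jk).
have [ki|ki] := eqVneq k i; last by case: (k == i').
by rewrite -ki (negbTE jk); case: (j == i').
Qed.

End Phases.

Variables (k l : nat) (D : {linear 'M[C]_k -> 'M[C]_l}) (b : K).
Hypothesis hD : local_bound D b.
Variable Z : 'I_k -> 'I_k -> 'M[C]_l.

Implicit Type phi : {ffun 'I_l -> 'I_4}.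

Definition compress (v : 'cV[C]_l) : 'M[C]_k := \matrix_(s, t) quad (Z t s) v.

Definition combine (a : 'cV[C]_k) : 'M[C]_l :=
  \sum_s \sum_t ((a s 0)^* * a t 0) *: Z t s.

Definition entry_mx (j i : 'I_l) : 'M[C]_k := \matrix_(s, t) Z t s j i.

Lemma quad_sum n (I : finType) (F : I -> 'M[C]_n) v :
  quad (\sum_i F i) v = \sum_i quad (F i) v.
Proof.
by rewrite quad_tr mulmx_suml raddf_sum; apply: eq_bigr => i _; rewrite quad_tr.
Qed.

(** Both sides evaluate one block operator on a product vector, contracting either factor first.
    This turns bounds on [combine] into bounds on the inputs given to [D]. *)
Lemma quad_compress v a : quad (compress v) a = quad (combine a) v.
Proof.
rewrite quad_sum quadE; apply: eq_bigr => s _; rewrite quad_sum.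
by apply: eq_bigr => t _; rewrite quadZ mxE mulrAC.
Qed.

Lemma entry_mxE (f : 'I_l -> 'I_l -> C) :
  \sum_j \sum_i f j i *: entry_mx j i =
  \matrix_(s, t) \sum_j \sum_i f j i * Z t s j i.
Proof.
apply/matrixP => s t; rewrite mxE summxE; apply: eq_bigr => j _.
by rewrite summxE; apply: eq_bigr => i _; rewrite !mxE.
Qed.

Lemma compress_delta i : compress (delta_mx i 0) = entry_mx i i.
Proof. by apply/matrixP => s t; rewrite !mxE quad_delta. Qed.

Lemma pairing_entry : pairing D Z = \sum_i \sum_j D (entry_mx j i) i j.
Proof.
have DE j i : D (entry_mx j i) = \sum_s \sum_t Z t s j i *: D (delta_mx s t).
  rewrite [entry_mx j i]matrix_sum_delta (raddf_sum D); apply: eq_bigr => s _.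
  rewrite (raddf_sum D); apply: eq_bigr => t _.
  by rewrite mxE; apply: linearZ.
transitivity (\sum_i \sum_j \sum_s \sum_t Z t s j i * D (delta_mx s t) i j).
  rewrite /pairing pair_bigA /=.
  transitivity (\sum_p \sum_i \sum_j Z p.2 p.1 j i * D (delta_mx p.1 p.2) i j).
    apply: eq_bigr => p _; rewrite exchange_big; apply: eq_bigr => j _.
    by rewrite mxE.
  rewrite exchange_big; apply: eq_bigr => i _.
  by rewrite exchange_big; apply: eq_bigr => j _; rewrite pair_bigA.
apply: eq_bigr => i _; apply: eq_bigr => j _; rewrite DE summxE.
by apply: eq_bigr => s _; rewrite summxE; apply: eq_bigr => t _; rewrite mxE.
Qed.

Hypothesis l0 : (0 < l)%N.
Hypothesis hZ : forall a, psd (quad 1%:M a *: 1%:M - combine a) /\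
                          psd (quad 1%:M a *: 1%:M + combine a).

Lemma contraction_compress v : quad 1%:M v = 1 -> contraction (compress v).
Proof.
move=> v1; apply: herm_contraction => a.
  have := (hZ a).1 v; rewrite !quadD !quadN quadZ v1 mulr1.
  by rewrite -quad_compress.
by have := (hZ a).2 v; rewrite !quadD quadZ v1 mulr1 -quad_compress.
Qed.

Definition offdiag (v : 'cV[C]_l) : 'M[C]_k :=
  compress v - \sum_i compress (delta_mx i 0).

(** With [G = combine a] and [q] the squared norm of [a], the form is [quad G v - \tr G]. The
    operators [q - G] and [q + G] are positive, so each has value at [v] between zero and [l] times
    its trace; these four inequalities combine linearly to the claim. *)
Lemma offdiag_bound a v : quad 1%:M v = l%:R ->
  exists2 x : K, quad (offdiag v) a = x%:C &
                 `|x| <= 2 * (l%:R - 1) * re (quad 1%:M a).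
Proof.
move=> vl; set q := quad 1%:M a; set G := combine a.
have [h1 h2] := hZ a; rewrite -/q -/G in h1 h2.
have q0 : 0 <= q := quad1_ge0 _.
have qE := ge0_reE q0.
have hG : G^t* = G.
  apply: (addrI (q *: 1%:M)); have := psd_herm h2.
  by rewrite trmxC_add trmxC_scale trmxC1 geC0_conj.
have realG u : quad G u = (re (quad G u))%:C.
  by rewrite RRe_real //; apply/CrealP; rewrite -quad_trmxC hG.
have trG : \tr G = (re (\tr G))%:C.
  by rewrite RRe_real //; apply/CrealP; rewrite -mxtrace_trmxC hG.
exists (re (quad G v) - re (\tr G)).
  rewrite /offdiag quadD quadN quad_compress quad_sum.
  rewrite (rmorphB (real_complex K)) /= -realG -trG; congr (_ - _).
  by apply: eq_bigr => i _; rewrite quad_compress quad_delta.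
have lC : l%:R = (l%:R)%:C :> C by rewrite (rmorph_nat (real_complex K)).
have trq : \tr (q *: 1%:M : 'M[C]_l) = q * l%:R by rewrite mxtraceZ mxtrace1.
move: (h1 v) (h2 v) (quad_le_trace v h1) (quad_le_trace v h2).
rewrite !quadD !quadN !quadZ !raddfD !raddfN /= trq vl realG trG lC qE /=.
set x := re _; set t := re _; set p := re _; set L : K := l%:R.
have L1 : 1 <= L by rewrite ler1n.
rewrite -!(rmorphM (real_complex K), rmorphD (real_complex K),
           rmorphN (real_complex K), rmorphB (real_complex K)).
rewrite !ler0c !lecR => e1 e2 e3 e4.
rewrite ler_norml; apply/andP; split; rewrite -(@ler_pM2l _ L) ?(lt_le_trans ltr01) //.
  by nra.
by nra.
Qed.

Lemma quad_phase phi : quad 1%:M (phase phi) = l%:R.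
Proof.
rewrite quad1 (eq_bigr (fun=> 1)) => [|i _]; first by rewrite sumr_const card_ord.
by rewrite mxE normCK powi_conj.
Qed.

Lemma contraction_offdiag phi : (1 < l)%N ->
  contraction ((2 * (l%:R - 1))^-1%:C *: offdiag (phase phi)).
Proof.
move=> l1; have g0 : 0 < 2 * (l%:R - 1) :> K by rewrite mulr_gt0 // subr_gt0 ltr1n.
have gi0 : 0 < (2 * (l%:R - 1))^-1 :> K by rewrite invr_gt0.
apply: herm_contraction => a; rewrite !quadD ?quadN quadZ;
  have [x -> ] := offdiag_bound a (quad_phase phi);
  have qE := ge0_reE (quad1_ge0 a); rewrite [quad _ _ in X in _ -> X]qE;
  rewrite -(rmorphM (real_complex K)) -?(rmorphN (real_complex K))
    -(rmorphD (real_complex K)) ler0c ler_norml => /andP[x1 x2].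
  by rewrite subr_ge0 ler_pdivrMl.
by rewrite -[X in _ + X]opprK subr_ge0 -mulrN ler_pdivrMl // lerNl.
Qed.

Lemma offdiag_phase phi : offdiag (phase phi) =
  \sum_j \sum_i (if j == i then 0 else (phase phi j 0)^* * phase phi i 0) *: entry_mx j i.
Proof.
rewrite entry_mxE; apply/matrixP => s t; rewrite addmxE oppmxE summxE !mxE quadE.
rewrite -sumrB; apply: eq_bigr => j _; rewrite compress_delta mxE.
rewrite (bigD1 j) //= [in RHS](bigD1 j) //= eqxx mul0r add0r.
rewrite !mxE mulrAC [_^* * _]mulrC powi_conj mul1r [LHS]addrC addKr.
by apply: eq_bigr => i /negbTE ij; rewrite eq_sym ij mulrAC.
Qed.

(** For [j != i] the fourth moment selects, among all entries of [D (entry_mx j i)], the single one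
    at [(i, j)]. *)
Lemma pairing_offdiag :
  \sum_i \sum_(j | j != i) D (entry_mx j i) i j =
  (4 ^+ l)^-1 * \sum_phi quad (D (offdiag (phase phi))) (phase phi).
Proof.
have DE phi : D (offdiag (phase phi)) = \sum_j \sum_i
    (if j == i then 0 else (phase phi j 0)^* * phase phi i 0) *: D (entry_mx j i).
  rewrite offdiag_phase (raddf_sum D); apply: eq_bigr => j _.
  by rewrite (raddf_sum D); apply: eq_bigr => i _; apply: linearZ.
have -> : \sum_phi quad (D (offdiag (phase phi))) (phase phi) =
    \sum_j \sum_i \sum_x \sum_y D (entry_mx j i) x y *
      \sum_phi (if j == i then 0 else (phase phi x 0)^* * phase phi y 0 *
         ((phase phi j 0)^* * phase phi i 0)).
  under eq_bigr => phi _ do rewrite DE quad_sum.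
  rewrite exchange_big; apply: eq_bigr => j _.
  under eq_bigr => phi _ do rewrite quad_sum.
  rewrite exchange_big; apply: eq_bigr => i _.
  under eq_bigr => phi _ do rewrite quadZ quadE mulr_sumr.
  rewrite exchange_big; apply: eq_bigr => x _.
  under eq_bigr => phi _ do rewrite mulr_sumr.
  rewrite exchange_big; apply: eq_bigr => y _; rewrite mulr_sumr.
  apply: eq_bigr => phi _; case: ifP => _; first by rewrite mul0r mulr0.
  by ring.
rewrite [in RHS]exchange_big mulr_sumr; apply: eq_bigr => i _.
rewrite mulr_sumr big_mkcond; apply: eq_bigr => j _.
case: (eqVneq j i) => [_|ji] /=.
  rewrite big1 ?mulr0 // => x _; rewrite big1 // => y _.
  by rewrite big1 ?mulr0.
have n0 : 4 ^+ l != 0 :> C by rewrite expf_neq0 // pnatr_eq0.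
under eq_bigr => x _ do under eq_bigr => y _ do rewrite phase_fourth_moment //.
rewrite (bigD1 i) //= [X in _ * (_ + X)]big1 => [|x /negbTE xi]; last first.
  by rewrite big1 // => y _; rewrite eq_sym xi mulr0n mulr0.
rewrite addr0 (bigD1 j) //= big1 => [|y /negbTE yj]; last first.
  by rewrite [j == y]eq_sym yj andbF mulr0n mulr0.
by rewrite !eqxx addr0 mulr1n mulrC mulfK.
Qed.

(* On the diagonal measure in the standard basis; off the diagonal measure the
   phase vectors, each of which sees the trace norm [2 (l - 1)] of
   [psi psi^* - 1]. *)
Lemma pairing_bound_right : re (pairing D Z) <= (2 * l%:R - 1) * b.
Proof.
have trL v (X : 'M[C]_l) : \tr (v *m v^t* *m X) = quad X v.
  by rewrite mxtrace_mulC quad_tr.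
have -> : pairing D Z = \sum_i quad (D (compress (delta_mx i 0))) (delta_mx i 0) +
    \sum_i \sum_(j | j != i) D (entry_mx j i) i j.
  rewrite pairing_entry -big_split; apply: eq_bigr => i _.
  by rewrite (bigD1 i) //= quad_delta compress_delta.
have diag : re (\sum_i quad (D (compress (delta_mx i 0))) (delta_mx i 0)) <= b.
  under eq_bigr => i _ do rewrite -trL.
  apply: hD => [i||i]; first exact: psd_gramC.
    rewrite mx1_sum_delta; apply: eq_bigr => i _.
    by rewrite trmx_delta map_delta_mx mul_delta_mx.
  by apply: contraction_compress; rewrite quad_delta mxE eqxx.
(* In dimension one there are no off-diagonal terms, and the scaling by [2 * (l - 1)] cannot be
   inverted. *)
have [l1|l1] := leqP l 1.
  rewrite [X in _ + X]big1 ?addr0 => [|i _]; last first.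
    rewrite big1 // => j ji; case/eqP: ji; apply: val_inj => /=.
    by have := ltn_ord j; have := ltn_ord i; lia.
  suff -> : (2 * l%:R - 1) * b = b by [].
  have -> : l%:R = 1 :> K by rewrite (_ : l = 1%N) //; lia.
  by ring.
have g0 : 0 < 2 * (l%:R - 1) :> K by rewrite mulr_gt0 // subr_gt0 ltr1n.
have -> : (2 * l%:R - 1) * b = b + 2 * (l%:R - 1) * b by ring.
rewrite reD lerD // -ler_pdivrMl // -reMl.
have p0 : 0 <= (4 ^+ l)^-1 :> C by rewrite invr_ge0 exprn_ge0.
have n0 : 4 ^+ l != 0 :> C by rewrite expf_neq0 // pnatr_eq0.
pose L phi : 'M[C]_l := (4 ^+ l)^-1 *: (phase phi *m (phase phi)^t*).
pose f phi := (2 * (l%:R - 1))^-1%:C *: offdiag (phase phi).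
suff -> : (2 * (l%:R - 1))^-1%:C * (\sum_i \sum_(j | j != i) D (entry_mx j i) i j) =
    \sum_phi \tr (L phi *m D (f phi)).
  apply: hD => [phi||phi].
  - exact: (psdZ p0 (psd_gramC _)).
  - rewrite -scaler_sumr; apply/matrixP => i j; rewrite scalemxE summxE.
    under eq_bigr => phi _ do rewrite mxE big_ord1 [(_ ^t*) _ _]mxE [_^T _ _]mxE.
    rewrite phase_second_moment mxE; case: eqP => _; last by rewrite mulr0n mulr0.
    by rewrite mulr1n mulVf.
  - exact: contraction_offdiag.
rewrite pairing_offdiag !mulr_sumr; apply: eq_bigr => phi _.
have -> : D (f phi) = (2 * (l%:R - 1))^-1%:C *: D (offdiag (phase phi)) by apply: linearZ.
by rewrite -scalemxAl -scalemxAr !mxtraceZ trL mulrCA.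
Qed.

End RightBound.

(** * The trace norm of Hermitian matrices *)

Section TraceNorm.
Variable K : realType.
Local Notation C := K[i].
Local Notation re := (@complex.Re K).
Local Notation normc := (@Normc.normc K).
Local Notation "x %:C" := (real_complex K x) : ring_scope.

Lemma diag_intertwine n (W : 'M[C]_n) (D E : 'rV[C]_n) i j :
  diag_mx E *m W = W *m diag_mx D *m diag_mx D ->
  W i j != 0 -> E 0 i = D 0 j ^+ 2.
Proof.
move=> /matrixP /(_ i j) + Wij; rewrite mul_diag_mx !mul_mx_diag !mxE.
by rewrite mulrC -mulrA => /(mulfI Wij).
Qed.

(* Both [x^* x] and [x^2] are diagonal up to a unitary [W]; an entry of [W] can
   only link an eigenvalue of the first to an equal eigenvalue of the second. *)
Lemma trace_norm_herm n (x : 'M[C]_n) : x^t* = x ->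
  trace_norm x = \sum_i `|eigval x i|.
Proof.
move=> hx; rewrite /trace_norm hx; set Y := x *m x.
have hY : Y^t* = Y by rewrite trmxC_mul hx.
pose U := spectralmx x; pose V := spectralmx Y; pose W := V *m U^t*.
have hU : U \is unitarymx := spectral_unitarymx x.
have hV : V \is unitarymx := spectral_unitarymx Y.
have hW : W \is unitarymx by apply: mul_unitarymx; rewrite ?trmxC_unitary.
have comm : diag_mx (spectral_diag Y) *m W =
    W *m diag_mx (spectral_diag x) *m diag_mx (spectral_diag x).
  rewrite -(spectral_diag_herm hY) -/V -(spectral_diag_herm hx) -/U /W !mulmxA.
  rewrite -[_ *m V^t* *m V]mulmxA (unitary_mulVmx hV) mulmx1.
  rewrite -[V *m U^t* *m U]mulmxA (unitary_mulVmx hU) mulmx1.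
  by rewrite -[_ *m U^t* *m U]mulmxA (unitary_mulVmx hU) mulmx1 /Y ?mulmxA.
have link i j : W i j != 0 -> sqrtC (spectral_diag Y 0 i) = (`|eigval x j|)%:C.
  move=> /(diag_intertwine comm) ->; rewrite (eigvalE _ hx) -rmorphXn.
  rewrite -real_normK ?num_real //.
  by rewrite rmorphXn sqrCK // ler0c.
rewrite re_sum.
transitivity (\sum_i \sum_j normc (W i j) ^+ 2 * `|eigval x j|).
  apply: eq_bigr => i _; rewrite -[LHS]mul1r -(unitary_row_sum i hW) mulr_suml.
  apply: eq_bigr => j _; have [->|/link ->//] := eqVneq (W i j) 0.
  by rewrite Normc.normc0 expr0n /= !mul0r.
by rewrite exchange_big; apply: eq_bigr => j _; rewrite -mulr_suml unitary_col_sum ?mul1r.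
Qed.

Lemma trace_norm_ge0 n (x : 'M[C]_n) : x^t* = x -> 0 <= trace_norm x.
Proof. by move=> /trace_norm_herm ->; apply: sumr_ge0. Qed.

Lemma trace_norm_sign n (x : 'M[C]_n) : x^t* = x ->
  exists W : 'M[C]_n, [/\ W^t* = W, W *m W = 1%:M & trace_norm x = re (\tr (W *m x))].
Proof.
move=> hx; pose U := spectralmx x; have hU : U \is unitarymx := spectral_unitarymx x.
(* A zero eigenvalue gets sign [1], so that the sign matrix squares to the identity. *)
pose s : 'rV[C]_n := \row_i (if 0 <= eigval x i then 1 else -1).
have ss : diag_mx s *m diag_mx s = 1%:M.
  rewrite mulmx_diag; apply/matrixP => i j; rewrite !mxE.
  by case: ifP; rewrite ?mulrNN mulr1.
have sC : (diag_mx s)^t* = diag_mx s.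
  rewrite trmxC_diag; congr diag_mx; apply/rowP => i; rewrite !mxE.
  by case: ifP; rewrite ?rmorphN rmorph1.
exists (U^t* *m diag_mx s *m U); split.
- by rewrite !trmxC_mul trmxCK sC mulmxA.
- rewrite !mulmxA -[_ *m U *m U^t*]mulmxA (unitarymxP hU) mulmx1.
  by rewrite -[_ *m diag_mx s *m diag_mx s]mulmxA ss mulmx1 unitary_mulVmx.
- have -> : \tr (U^t* *m diag_mx s *m U *m x) = \tr (diag_mx s *m (U *m x *m U^t*)).
    by rewrite -!mulmxA mxtrace_mulC !mulmxA.
  rewrite trace_norm_herm // (spectral_diag_herm hx) mulmx_diag mxtrace_diag re_sum.
  apply: eq_bigr => i _; rewrite !mxE eigvalE //.
  case: ifP => [l0|/negbT]; first by rewrite mul1r ger0_norm.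
  by rewrite -ltNge => l0; rewrite mulN1r reN ltr0_norm.
Qed.

Lemma herm_spectral_sum n (x : 'M[C]_n) : x^t* = x ->
  exists w : 'I_n -> 'cV[C]_n, (forall j, quad 1%:M (w j) = 1) /\
    x = \sum_j (eigval x j)%:C *: (w j *m (w j)^t*).
Proof.
move=> hx; pose U := spectralmx x; have hU : U \is unitarymx := spectral_unitarymx x.
exists (fun j => (row j U)^t*); split=> [j|].
  rewrite /quad mulmx1 trmxCK; have /matrixP/(_ j j) := unitarymxP hU.
  rewrite !mxE eqxx mulr1n => <-; apply: eq_bigr => i _.
  by rewrite !mxE.
rewrite {1}(herm_spectral hx) -/U; apply/matrixP => a c.
rewrite mul_mx_diag mxE summxE; apply: eq_bigr => j _.
by rewrite scalemxE trmxCK !mxE big_ord1 !mxE eigvalE // mulrAC mulrC mulrA.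
Qed.

End TraceNorm.

(** * Rank-one inputs with ancilla as block pairings *)

Section Diamond.
Variable K : realType.
Local Notation C := K[i].
Local Notation re := (@complex.Re K).
Local Notation "x %:C" := (real_complex K x) : ring_scope.

(* The operator [1 (x) h] from [C^l] to [C^l (x) C^m]. *)
Definition tensvec l m (h : 'I_m -> C) : 'M[C]_(l * m, l) :=
  \matrix_(u, i) (h (mxtens_unindex u).2 *+ ((mxtens_unindex u).1 == i)).

Lemma tensvecE l m (h : 'I_m -> C) i a i' :
  tensvec l h (mxtens_index (i, a)) i' = h a *+ (i == i').
Proof. by rewrite mxE mxtens_indexK. Qed.

Lemma tensvec_trmxCE l m (h : 'I_m -> C) i a i' :
  (tensvec l h)^t* i' (mxtens_index (i, a)) = (h a)^* *+ (i == i').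
Proof. by rewrite !mxE mxtens_indexK rmorphMn. Qed.

Lemma tensvec_gram l m (h g : 'I_m -> C) :
  (tensvec l h)^t* *m tensvec l g = (\sum_a (h a)^* * g a)%:M.
Proof.
apply/matrixP => i j; rewrite !mxE sum_mxtens (bigD1 i) //= [X in _ + X]big1 ?addr0.
  rewrite -sumrMnl; apply: eq_bigr => a _.
  by rewrite tensvec_trmxCE tensvecE eqxx mulr1n mulrnAr.
move=> i' /negbTE ii'; rewrite big1 // => a _.
by rewrite tensvec_trmxCE ii' mul0r.
Qed.

Lemma tensvec_sum l m k (c : 'I_k -> C) (h : 'I_k -> 'I_m -> C) :
  \sum_s c s *: tensvec l (h s) = tensvec l (fun a => \sum_s c s * h s a).
Proof.
apply/matrixP => u i; rewrite summxE !mxE -sumrMnl.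
by apply: eq_bigr => s _; rewrite !mxE mulrnAr.
Qed.

Variables (k l m : nat) (D : {linear 'M[C]_k -> 'M[C]_l}).

Let slice (w : 'cV[C]_(k * m)) s : 'I_m -> C := fun a => w (mxtens_index (s, a)) 0.

(** Expand [w] as the sum of [e_s] tensor [slice w s]; only the slices see the ancilla. *)
Lemma tens_id_rank1 (w : 'cV[C]_(k * m)) :
  tens_id D (w *m w^t*) = \sum_s \sum_t
    tensvec l (slice w s) *m D (delta_mx s t) *m (tensvec l (slice w t))^t*.
Proof.
apply/matrixP => u v; case: (mxtens_indexP u) => i a; case: (mxtens_indexP v) => j c.
rewrite mxE !mxtens_indexK [X in D X]matrix_sum_delta (raddf_sum D) !summxE.
apply: eq_bigr => s _; rewrite (raddf_sum D) !summxE; apply: eq_bigr => t _.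
have DZ y A : D (y *: A) i j = y * D A i j by rewrite linearZ mxE.
apply: etrans (DZ _ _) _.
have -> : (\matrix_(s, t) (w *m w^t*) (mxtens_index (s, a)) (mxtens_index (t, c))) s t =
    slice w s a * (slice w t c)^* by rewrite !mxE big_ord1 !mxE.
rewrite [RHS]mxE (bigD1 j) //= big1 ?addr0; last first.
  by move=> j' /negbTE jj; rewrite tensvec_trmxCE eq_sym jj mulr0.
rewrite mxE (bigD1 i) //= big1 ?addr0; last first.
  by move=> i' /negbTE ii; rewrite tensvecE eq_sym ii mul0r.
rewrite tensvecE tensvec_trmxCE !eqxx !mulr1n.
by rewrite mulrAC.
Qed.

Variables (w : 'cV[C]_(k * m)) (W : 'M[C]_(l * m)).
Hypotheses (w1 : quad 1%:M w = 1) (hW : W^t* = W) (WW : W *m W = 1%:M).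

Let V s := tensvec l (slice w s).
Let Z t s := (V t)^t* *m W *m V s.

Lemma tr_tens_id_rank1 : \tr (W *m tens_id D (w *m w^t*)) = pairing D Z.
Proof.
rewrite tens_id_rank1 mulmx_sumr raddf_sum; apply: eq_bigr => s _.
rewrite mulmx_sumr raddf_sum; apply: eq_bigr => t _ /=.
by rewrite mulmxA mxtrace_mulC /Z /V !mulmxA.
Qed.

Let sum_slice : \sum_s \sum_a `|slice w s a| ^+ 2 = 1.
Proof. by rewrite -w1 quad1 sum_mxtens. Qed.

(** The sum of [V s *m (V s)^t*] is the identity tensored with a density matrix of the ancilla,
    hence at most one; the [(V t)^t* *m V t] add up to the identity, and [W] is unitary in
    between. *)
Lemma psd_slices_left : psd (1%:M - \sum_s \sum_t Z t s *m (Z t s)^t*).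
Proof.
have VV : \sum_t (V t)^t* *m V t = 1%:M.
  under eq_bigr => t _ do rewrite tensvec_gram.
  rewrite -raddf_sum /= -sum_slice; congr (_ %:M); apply: eq_bigr => t _.
  by apply: eq_bigr => a _; rewrite normCKC.
have subV : psd (1%:M - \sum_s V s *m (V s)^t*).
  move=> g; rewrite quadD quadN quad_sum subr_ge0 quad1 sum_mxtens.
  pose G s i := \sum_a (slice w s a)^* * g (mxtens_index (i, a)) 0.
  have -> : \sum_s quad (V s *m (V s)^t*) g = \sum_i \sum_s `|G s i| ^+ 2.
    rewrite exchange_big; apply: eq_bigr => s _.
    rewrite -{1}[V s]trmxCK quad_gram quad1; apply: eq_bigr => i _.
    congr (`|_| ^+ 2); rewrite mxE sum_mxtens (bigD1 i) //= [X in _ + X]big1 ?addr0.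
      by apply: eq_bigr => a _; rewrite tensvec_trmxCE eqxx.
    move=> j /negbTE ji; rewrite big1 // => a _.
    by rewrite tensvec_trmxCE ji mul0r.
  apply: ler_sum => i _; rewrite -[leRHS]mul1r -sum_slice mulr_suml.
  apply: ler_sum => s _; apply: le_trans (sum_cauchy_schwarz _ _) _.
  by under eq_bigr => a _ do rewrite norm_conjC.
have -> : 1%:M - \sum_s \sum_t Z t s *m (Z t s)^t* =
    \sum_t (W *m V t)^t* *m (1%:M - \sum_s V s *m (V s)^t*) *m (W *m V t).
  under [RHS]eq_bigr => t _ do
    rewrite mulmxBr mulmxBl mulmx1 trmxC_mul hW mulmxA -[_ *m W *m W]mulmxA WW mulmx1.
  rewrite sumrB VV exchange_big; congr (_ - _); apply: eq_bigr => t _ /=.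
  rewrite mulmx_sumr mulmx_suml; apply: eq_bigr => s _.
  by rewrite /Z !trmxC_mul trmxCK hW !mulmxA.
by apply: psd_sum => t _; apply: psd_conj.
Qed.

(** Linearity of [tensvec] gives [combine Z a = T^t* *m W *m T] with a single [T]; Cauchy-Schwarz
    bounds [T^t* *m T] by the squared norm of [a], and [W] lies between [-1] and [1]. *)
Lemma psd_slices_right a : psd (quad 1%:M a *: 1%:M - combine Z a) /\
                           psd (quad 1%:M a *: 1%:M + combine Z a).
Proof.
pose T : 'M[C]_(l * m, l) := \sum_s (a s 0)^* *: V s.
have combE : combine Z a = T^t* *m W *m T.
  rewrite /combine /T mulmx_sumr; apply: eq_bigr => s _.
  rewrite trmxC_sum !mulmx_suml; apply: eq_bigr => t _.
  rewrite trmxC_scale conjCK -!scalemxAl -scalemxAr scalerA.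
  by rewrite /Z [in RHS]mulrC.
have TT : psd (quad 1%:M a *: 1%:M - T^t* *m T).
  rewrite /T tensvec_sum tensvec_gram quad1 scale_scalar_mx mulr1 -raddfB /=.
  rewrite -scalemx1; apply: psdZ; last exact: psd1.
  rewrite subr_ge0.
  under eq_bigr => c _ do rewrite -normCKC.
  apply: (@le_trans _ _ (\sum_c (\sum_s `|a s 0| ^+ 2) * \sum_s `|slice w s c| ^+ 2)).
    apply: ler_sum => c _; apply: le_trans (sum_cauchy_schwarz _ _) _.
    by under eq_bigr => s _ do rewrite norm_conjC.
  by rewrite -mulr_sumr exchange_big sum_slice mulr1.
(* For a sign [e], [1 + e W] is half its own square. *)
have half (e : C) : e * e = 1 -> e^* = e -> psd (1%:M + e *: W).
  move=> e2 ec; have -> : 1%:M + e *: W =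
      2^-1 *: ((1%:M + e *: W)^t* *m (1%:M + e *: W)).
    rewrite trmxC_add trmxC_scale trmxC1 hW ec mulmxDl !mulmxDr !mul1mx mulmx1.
    rewrite -scalemxAl -scalemxAr WW scalerA e2 scale1r.
    rewrite [e *: W + _]addrC -mulr2n -[(_ + _) *+ 2]scaler_nat scalerA.
    by rewrite mulVf ?scale1r ?pnatr_eq0.
  by apply: psdZ; [rewrite invr_ge0 ler0n | apply: psd_gram].
have combined e : psd (1%:M + e *: W) -> psd (quad 1%:M a *: 1%:M + e *: combine Z a).
  move=> he; have -> : quad 1%:M a *: 1%:M + e *: combine Z a =
      (quad 1%:M a *: 1%:M - T^t* *m T) + T^t* *m (1%:M + e *: W) *m T.
    rewrite mulmxDr mulmxDl mulmx1 -scalemxAr -scalemxAl -combE.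
    by rewrite addrA subrK.
  by apply: psdD TT _; apply: psd_conj.
split; last first.
  by rewrite -[combine Z a]scale1r; apply/combined/half; rewrite ?mulr1 ?rmorph1.
by rewrite -scaleN1r; apply/combined/half; rewrite ?mulrNN ?mulr1 ?rmorphN ?rmorph1.
Qed.

End Diamond.

(** * The diamond norm bound *)

Section DiamondNorm.
Variable K : realType.
Local Notation C := K[i].
Local Notation re := (@complex.Re K).
Local Notation "x %:C" := (real_complex K x) : ring_scope.
Variables (k l : nat) (D : {linear 'M[C]_k -> 'M[C]_l}) (b : K).
Hypotheses (k0 : (0 < k)%N) (l0 : (0 < l)%N) (hD : local_bound D b).
Hypothesis hermD : forall x, D (x^t*) = (D x)^t*.

Lemma tens_id_trmxC m (x : 'M[C]_(k * m)) : tens_id D (x^t*) = (tens_id D x)^t*.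
Proof.
apply/matrixP => u v; case: (mxtens_indexP u) => i a; case: (mxtens_indexP v) => j c.
rewrite [RHS]mxE [(_ ^T) _ _]mxE !mxE !mxtens_indexK.
transitivity ((D (\matrix_(s, t) x (mxtens_index (s, c)) (mxtens_index (t, a))))^t* i j).
  by rewrite -hermD; congr (D _ i j); apply/matrixP => s t; rewrite !mxE.
by rewrite !mxE.
Qed.

Lemma tens_id_sum m (I : finType) (c : I -> C) (x : I -> 'M[C]_(k * m)) :
  tens_id D (\sum_y c y *: x y) = \sum_y c y *: tens_id D (x y).
Proof.
apply/matrixP => u v; case: (mxtens_indexP u) => i a; case: (mxtens_indexP v) => j e.
rewrite mxE !mxtens_indexK summxE.
have -> : \matrix_(s, t) (\sum_y c y *: x y) (mxtens_index (s, a)) (mxtens_index (t, e)) =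
    \sum_y c y *: \matrix_(s, t) x y (mxtens_index (s, a)) (mxtens_index (t, e)).
  by apply/matrixP => s t; rewrite !(mxE, summxE); apply: eq_bigr => y _; rewrite !mxE.
rewrite (raddf_sum D) summxE; apply: eq_bigr => y _.
have DZ A : D (c y *: A) i j = c y * D A i j by rewrite linearZ mxE.
by apply: etrans (DZ _) _; rewrite !mxE !mxtens_indexK.
Qed.

Lemma tens_id_trace_norm m B (x : 'M[C]_(k * m)) : 0 <= B ->
  (2 * k%:R * b <= B) \/ ((2 * l%:R - 1) * b <= B) -> x^t* = x ->
  trace_norm (tens_id D x) <= B * trace_norm x.
Proof.
move=> B0 hB hx; have hy : (tens_id D x)^t* = tens_id D x by rewrite -tens_id_trmxC hx.
have [W [hW WW ->]] := trace_norm_sign hy.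
have rank1 (U : 'M[C]_(l * m)) (w : 'cV[C]_(k * m)) :
    U^t* = U -> U *m U = 1%:M -> quad 1%:M w = 1 ->
    re (\tr (U *m tens_id D (w *m w^t*))) <= B.
  move=> hU UU w1; rewrite tr_tens_id_rank1; case: hB; apply: le_trans.
    exact: (@pairing_bound_left _ _ _ D b hD _ k0 (psd_slices_left w1 hU UU)).
  exact: (@pairing_bound_right _ _ _ D b hD _ l0 (psd_slices_right w1 hU UU)).
have [w [w1 xE]] := herm_spectral_sum hx.
rewrite [x in tens_id D x]xE tens_id_sum mulmx_sumr.
rewrite (raddf_sum (@mxtrace C (l * m))) re_sum trace_norm_herm // mulr_sumr.
apply: ler_sum => j _ /=.
rewrite -scalemxAr mxtraceZ reMl.
have [e0|e0] := lerP 0 (eigval x j).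
  by rewrite ger0_norm // [leLHS]mulrC ler_wpM2r // rank1.
(* A negative sign moves into the observable: [- W] is again a Hermitian involution. *)
rewrite ltr0_norm // -mulrNN [leLHS]mulrC; apply: ler_wpM2r.
  by rewrite oppr_ge0 ltW.
rewrite -reN -raddfN -mulNmx; apply: rank1 => //.
- by rewrite trmxC_opp hW.
- by rewrite mulNmx mulmxN opprK.
Qed.

Lemma diamond_norm_le B :
  0 <= B -> (2 * k%:R * b <= B) \/ ((2 * l%:R - 1) * b <= B) ->
  (diamond_norm D <= B%:E)%E.
Proof.
move=> B0 hB; apply: ge_ereal_sup => _ [m m0 <-].
apply: ge_ereal_sup => _ [x [/hermP hx x0] <-].
rewrite lee_fin; have := trace_norm_ge0 hx; rewrite le_eqVlt => /predU1P[<-|t0].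
  (* Division by a zero trace norm returns zero, which is below [B]. *)
  by rewrite invr0 mulr0.
by rewrite ler_pdivrMr //; apply: tens_id_trace_norm.
Qed.

End DiamondNorm.

(** * Linearity and Hermiticity of the maps being compared *)

Section DefectLinear.
Variables (K : realType) (dA n : nat) (d : 'I_n -> nat).
Local Notation C := K[i].

Lemma mxtrace_mul_inj m (A B : 'M[C]_m) :
  (forall L, \tr (L *m A) = \tr (L *m B)) -> A = B.
Proof.
have trE (X : 'M[C]_m) i j : \tr (delta_mx j i *m X) = X i j.
  rewrite /mxtrace (bigD1 j) //= big1 ?addr0 => [|t /negbTE tj].
    rewrite mxE (bigD1 i) //= big1 ?addr0 => [|t /negbTE ti].
      by rewrite mxE !eqxx mul1r.
    by rewrite mxE ti andbF mul0r.
  by rewrite mxE big1 // => s _; rewrite mxE tj mul0r.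
by move=> h; apply/matrixP => i j; rewrite -!trE.
Qed.

Lemma ptrace_linear (R : {set 'I_n}) a (x y : 'M[C]_(dim_full d)) :
  ptrace R (a *: x + y) = a *: ptrace R x + ptrace R y.
Proof.
apply: mxtrace_mul_inj => L; rewrite -tr_emb !mulmxDr !raddfD /= -!scalemxAr.
by rewrite !mxtraceZ !tr_emb.
Qed.

Lemma ptrace_trmxC (R : {set 'I_n}) (x : 'M[C]_(dim_full d)) :
  ptrace R (x^t*) = (ptrace R x)^t*.
Proof.
apply: mxtrace_mul_inj => L; rewrite -tr_emb.
have e m (A B : 'M[C]_m) : \tr (A *m B^t*) = (\tr (A^t* *m B))^*.
  by rewrite -mxtrace_trmxC trmxC_mul trmxCK mxtrace_mulC.
by rewrite !e -emb_trmxC tr_emb.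
Qed.

Lemma measure_prepare_linear m p (I : finType) (M : I -> 'M[C]_m) (s : I -> 'M[C]_p)
    a x y :
  measure_prepare M s (a *: x + y) = a *: measure_prepare M s x + measure_prepare M s y.
Proof.
rewrite /measure_prepare scaler_sumr -big_split; apply: eq_bigr => z _ /=.
by rewrite mulmxDr raddfD /= -scalemxAr mxtraceZ scalerDl scalerA.
Qed.

Lemma measure_prepare_trmxC m p (I : finType) (M : I -> 'M[C]_m) (s : I -> 'M[C]_p) x :
  (forall z, (M z)^t* = M z) -> (forall z, (s z)^t* = s z) ->
  measure_prepare M s (x^t*) = (measure_prepare M s x)^t*.
Proof.
move=> hM hs; rewrite /measure_prepare trmxC_sum; apply: eq_bigr => z _.
by rewrite trmxC_scale hs -mxtrace_trmxC trmxC_mul hM mxtrace_mulC.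
Qed.

Variable Lambda : {linear 'M[C]_dA -> 'M[C]_(dim_full d)}.
Variables (I : finType) (N : I -> 'M[C]_(dim_full d)) (R : {set 'I_n}).

Lemma defect_linear : linear (defect Lambda N R).
Proof.
move=> a x y; rewrite /defect linearP ptrace_linear measure_prepare_linear.
by rewrite scalerBr opprD addrACA.
Qed.

HB.instance Definition _ := GRing.isLinear.Build C 'M[C]_dA 'M[C]_(dim_sub d R) *:%R
  (defect Lambda N R) defect_linear.

End DefectLinear.

Theorem theorem3p1 (K : realType) (dA n : nat) (d : 'I_n -> nat)
    (Lambda : {linear 'M[K[i]]_dA -> 'M[K[i]]_(dim_full d)})
    (hdA : (2 <= dA)%N) (hn : (1 <= n)%N) (hLambda : quantum_channel Lambda)
    (q r : nat) (hq : (1 <= q <= n)%N) (hr : (1 <= r <= n)%N) :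
  exists (I : finType) (M : I -> 'M[K[i]]_dA) (Q : {set 'I_n}),
    is_povm M /\ #|Q| = q /\
    forall R : {set 'I_n}, #|R| = r -> [disjoint R & Q] ->
      exists sigma : I -> 'M[K[i]]_(dim_sub d R),
        (forall a, is_state (sigma a)) /\
        (diamond_norm
           (fun x => ptrace R (Lambda x) - measure_prepare M sigma x)%R
         <= (dA%:R * Omega K dA (dim_sub d R) *
             Num.sqrt (2 * ln (dA%:R : K) * (#|R|%:R / #|Q|%:R)))%R%:E)%E.
Proof.
have [I [N [Q [psdN sumN locN cQ sat]]]] :=
  exists_saturating_measurement hLambda hdA hq hr.
have dA0 : (0 < dA)%N by apply: leq_trans hdA.
exists I, (fun z => adjoint Lambda (N z)), Q; split; [|split=> //].
  split=> [z|]; first exact/psdmxP/psd_adjoint.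
  by rewrite -adjoint_sum sumN adjoint1.
move=> R cR dis; exists (prepared Lambda N R).
have states := prepared_state hLambda dA0 psdN locN dis.
split=> //; rewrite cQ cR.
set eps : K := ln dA%:R * (r%:R / q%:R).
have eps0 : 0 < eps.
  rewrite mulr_gt0 ?ln_gt0 ?ltr1n // divr_gt0 // ltr0n; first by case/andP: hr.
  by case/andP: hq.
have hb := defect_local_bound hLambda psdN sumN locN dis eps0 (sat R cR dis).
set b := dA%:R * Num.sqrt (2 * eps) in hb.
have l0 := dim_sub_gt0 hLambda R dA0.
have herm x : defect Lambda N R (x^t*) = (defect Lambda N R x)^t*.
  rewrite /defect channel_trmxC // ptrace_trmxC measure_prepare_trmxC.
  - by rewrite trmxC_add trmxC_opp.
  - by move=> z; apply/psd_herm/psd_adjoint.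
  - by move=> z; apply/psd_herm/psdmxP/(states z).1.
have b0 : 0 <= b by rewrite mulr_ge0 // sqrtr_ge0.
have -> : dA%:R * Omega K dA (dim_sub d R) * Num.sqrt (2 * ln dA%:R * (r%:R / q%:R)) =
    Omega K dA (dim_sub d R) * b by rewrite /b /eps [RHS]mulrCA !mulrA.
have l1 : 1 <= (dim_sub d R)%:R :> K by rewrite ler1n.
have sqrt2 : 1 <= Num.sqrt 2 :> K by rewrite -[leLHS]sqrtr1 ler_sqrt // ler1n.
have dA1 : 1 <= dA%:R :> K by rewrite ler1n.
(* For [dA = 2] the constant [4] is exactly [2 * dA]; otherwise [2 * sqrt 2 * dA] exceeds it. So
   whichever entry attains the minimum, one of the two pairing bounds applies. *)
have Om : (2 * dA%:R <= Omega K dA (dim_sub d R)) \/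
          (Omega K dA (dim_sub d R) = 2 * (dim_sub d R)%:R - 1).
  rewrite /Omega; case: eqP => [->|_].
    by case: (lerP 4 (2 * (dim_sub d R)%:R - 1 : K)) => _; [left; rewrite -natrM|right].
  case: (lerP (2 * Num.sqrt 2 * dA%:R) (2 * (dim_sub d R)%:R - 1 : K)) => _;
    by [left; nra | right].
apply: (@diamond_norm_le K dA (dim_sub d R)
  (defect Lambda N R) b dA0 l0 hb herm).
  apply: mulr_ge0 b0; case: Om => [|->]; last by lra.
  by apply: le_trans; nra.
case: Om => [le|->]; [left; exact: ler_wpM2r | by right].
Qed.
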